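(* Let $\varepsilon>0$ and $K>0$. There exist constants $C>0$ and $C_1>0$ (depending only on $\varepsilon$ and $K$) such that for every finite set $A\subset\mathbb{C}$ each of the following holds: (1) if $\left|\frac{A+A}{A+A}\right|\le K|A|^2$, then $|A+A|\le C_1|A|^2\exp(-C\log^{1/3-\varepsilon}|A|)$; (2) if $|(A+A)(A+A)|\le K|A|^2$, then $|A+A|\le C_1|A|^2\exp(-C\log^{1/3-\varepsilon}|A|)$; (3) if $\left|\frac{A-A}{A-A}\right|\le K|A|^2$, then $|A-A|\le C_1|A|^2\exp(-C\log^{1/3-\varepsilon}|A|)$; (4) if $|(A-A)(A-A)|\le K|A|^2$, then $|A-A|\le C_1|A|^2\exp(-C\log^{1/3-\varepsilon}|A|)$.
   Context: For a finite set $A\subset\mathbb{C}$: $A+A=\{a+b:a,b\in A\}$, $A-A=\{a-b:a,b\in A\}$, $\frac{A\pm A}{A\pm A}=\left\{\frac{a\pm b}{c\pm d}:a,b,c,d\in A,\ c\pm d\neq0\right\}$ (with the same sign throughout), and for finite sets $X,Y$, $XY=\{xy:x\in X,y\in Y\}$. *)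

(* Defs.v *)
From HB Require Import structures.
From mathcomp Require Import all_boot all_order all_algebra.
From mathcomp Require Import finmap.
From mathcomp Require Import complex.
From mathcomp Require Import reals.
From mathcomp Require Import sequences exp.
Set Implicit Arguments. Unset Strict Implicit. Unset Printing Implicit Defensive.
Import Order.TTheory GRing.Theory Num.Theory.
Local Open Scope ring_scope.
Local Open Scope fset_scope.

Section SetOps.
Variable R : realType.
Implicit Types (A X Y : {fset R[i]}).

Definition sumset A : {fset R[i]} := [fset (a + b)%R | a in A, b in A].
Definition diffset A : {fset R[i]} := [fset (a - b)%R | a in A, b in A].
Definition prodset X Y : {fset R[i]} := [fset (x * y)%R | x in X, y in Y].
Definition ratioset X : {fset R[i]} := [fset (x / y)%R | x in X, y in X & (y != 0)%R].
End SetOps.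

Definition bound (R : realType) (C C1 eps : R) (n : nat) : R :=
  C1 * (n%:R) ^+ 2 * expR (- (C * powR (ln (n%:R)) (3^-1 - eps))).

(* Main.v *)
Require Import Defs.
From HB Require Import structures.
From mathcomp Require Import all_boot all_order all_algebra.
From mathcomp Require Import fingroup falgebra fieldext separable galois algC algnum.
From mathcomp Require Import finmap.
From mathcomp Require Import complex.
From mathcomp Require Import boolp reals.
From mathcomp Require Import sequences exp.
From mathcomp Require Import ring lra zify.

(** In fact |A + A| <= C |A|^(2 - c) for some c > 0. Let S be the nonzero part of
    A + A or A - A and suppose that |SS| or |S/S| is at most k |S|; Plünnecke's
    inequality (Petridis' proof) gives |S^n| <= k^n |S|. Fix two distinct
    translates of A inside S: after scaling, the elements of A yield |A| - 2
    solutions of x - y = 1 with x and y in S, so it is enough to bound the number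
    of such solutions by C k^C |A|^(1/2).

    A specialization makes S algebraic, where heights are available. Write
    H (x, y) = H x * H y. Three facts are used, the last two with absolute
    constants and logarithmic heights per degree:
    - H is a norm on pairs: submultiplicative, with H (v^2) = (H v)^2;
    - if v, w are distinct solutions, the height of v/w is at least a constant
      multiple of that of v, up to an additive constant (Cramer's rule);
    - only seven solutions w can have w/v of very small height: the relation
      between the quotients of three solutions is inherited by their seventh
      powers up to a multiple of 7, and a nonzero defect would have norm below 1.
    Hence the solutions of comparable height are separated, and a separated set D
    satisfies |D|^m <= |S^n|^2, since the products of the d_i^(Q^i), i < m, are
    distinct. Solutions with lacunary heights have distinct products as well,
    which bounds the number of scales. *)

Set Implicit Arguments. Unset Strict Implicit. Unset Printing Implicit Defensive.
Import Order.TTheory GRing.Theory Num.Theory.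
Local Open Scope fset_scope.
Local Open Scope ring_scope.

(** * Algebraic integers *)

Lemma Aint_integralOver (x : algC) :
  x \in Aint <-> integralOver (intr : int -> algC) x.
Proof.
split=> [|[p mon_p px0]]; last first.
  apply: root_monic_Aint px0 _ _; first exact: monic_map.
  by apply/polyOverP => i; rewrite coef_map /= rpred_int.
rewrite unfold_in => /floorpP[p Dp].
exists p; last by rewrite -Dp root_minCpoly.
move: (minCpoly_monic x); rewrite Dp !monicE lead_coef_map_inj ?rmorph0 //.
  by rewrite -[X in _ == X](rmorph1 intr) eqr_int.
exact: intr_inj.
Qed.

Lemma root_monic_Aint_closed (p : {poly algC}) x :
  p \is monic -> root p x -> p \is a polyOver Aint -> x \in Aint.
Proof.
move=> mon_p px0 /polyOverP pA; apply/Aint_integralOver.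
apply: (integral_root_monic mon_p px0) => c /(nthP 0)[i _ <-].
by apply/Aint_integralOver.
Qed.

(** With [c] the leading coefficient of a nonconstant [p] and [n] one less than its degree, c^n p(X)
    is monic in the variable cX, with coefficients in [Aint]. *)
Lemma lead_coef_root_Aint (p : {poly algC}) a :
  p \is a polyOver Aint -> root p a -> lead_coef p * a \in Aint.
Proof.
move=> /polyOverP pA pa0; have [-> | nz_p] := eqVneq p 0.
  by rewrite lead_coef0 mul0r.
set c := lead_coef p; have cA : c \in Aint by apply: pA.
have sz_p : (1 < size p)%N.
  by rewrite ltnNge; apply: contraL pa0 => /size1_polyC Dp;
     rewrite Dp rootC; apply: contra nz_p => /eqP c0; rewrite Dp c0.
pose n := (size p).-2; have Dn : size p = n.+2 by rewrite /n; lia.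
pose q : {poly algC} := 'X^(n.+1) + \poly_(i < n.+1) (c ^+ (n - i) * p`_i).
apply: (@root_monic_Aint_closed q).
- rewrite monicE lead_coefDl ?lead_coefXn // size_polyXn ltnS.
  exact: size_poly.
- rewrite /root /q hornerD hornerXn horner_poly.
  apply/eqP; transitivity (c ^+ n * p.[a]); last by rewrite (eqP pa0) mulr0.
  rewrite horner_coef Dn [in RHS]big_ord_recr /= mulrDr addrC; congr (_ + _).
    rewrite mulr_sumr; apply: eq_bigr => i _.
    rewrite exprMn [c ^+ n](_ : _ = c ^+ (n - i) * c ^+ i); first by ring.
    by rewrite -exprD subnK // -ltnS.
  by rewrite /c lead_coefE Dn /= exprMn exprS; ring.
- rewrite rpredD ?rpredX ?polyOverX //; apply/polyOverP => i.
  by rewrite coef_poly; case: ifP => // _; rewrite rpredM ?rpredX.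
Qed.

(** A form of Gauss's lemma without contents. The leading term [r] of [p] can be split off, since r
    (X - a) has coefficients in [Aint] by [lead_coef_root_Aint]; the rest has smaller degree. *)
Lemma polyOver_Aint_div_XsubC (p : {poly algC}) a :
  p * ('X - a%:P) \is a polyOver Aint -> p \is a polyOver Aint.
Proof.
move: {2}(size p) (leqnn (size p)) => n; elim: n p => [|n IHn] p.
  by rewrite leqn0 size_poly_eq0 => /eqP ->; rewrite rpred0.
move=> szp pA; have [-> | nz_p] := eqVneq p 0; first by rewrite rpred0.
have Dc : lead_coef (p * ('X - a%:P)) = lead_coef p.
  by rewrite lead_coefM lead_coefXsubC mulr1.
have cA : lead_coef p \in Aint.
  by move/polyOverP: (pA) => pA'; rewrite -Dc lead_coefE.
have caA : lead_coef p * a \in Aint.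
  by rewrite -Dc; apply: lead_coef_root_Aint; rewrite // rootM root_XsubC eqxx orbT.
set k := (size p).-1; have szk : size p = k.+1.
  by rewrite /k prednK // lt0n size_poly_eq0.
pose r := lead_coef p *: 'X^k : {poly algC}.
have rA : r * ('X - a%:P) \is a polyOver Aint.
  rewrite /r -scalerAl mulrBr scalerBr -exprSr rpredB //.
    by rewrite polyOverZ // rpredX // polyOverX.
  by rewrite mulrC mul_polyC scalerA polyOverZ // rpredX // polyOverX.
rewrite -(subrK r p) rpredD //; last by rewrite polyOverZ // rpredX // polyOverX.
apply: IHn; last by rewrite mulrBl rpredB.
apply: (@leq_trans k); last by rewrite -ltnS -szk.
apply/leq_sizeP => i lei; rewrite coefB coefZ coefXn.
move: lei; rewrite leq_eqVlt => /orP [/eqP <-|lti].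
  by rewrite eqxx mulr1 lead_coefE subrr.
by rewrite gtn_eqF // mulr0 subr0 nth_default // szk.
Qed.

(* Dividing out the roots outside J one at a time stays in Aint[X]; the claim is
   the constant coefficient of what remains. *)
Lemma lead_coef_prod_roots_Aint (G : finType) (c : algC) (z : G -> algC)
    (J : {set G}) :
  c *: \prod_g ('X - (z g)%:P) \is a polyOver Aint ->
  c * \prod_(g in J) z g \in Aint.
Proof.
move=> cA.
suff: c *: \prod_(g in J) ('X - (z g)%:P) \is a polyOver Aint.
  move/polyOverP/(_ 0); rewrite coefZ -horner_coef0 horner_prod.
  under eq_bigr do rewrite hornerXsubC sub0r.
  rewrite prodrN mulrCA => h.
  by rewrite -(@rpredMsign _ Aint #|J|).
have: c *: \prod_(g in J :|: ~: J) ('X - (z g)%:P) \is a polyOver Aint.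
  rewrite setUCr; congr (_ *: _ \is a _): cA.
  by apply: eq_bigl => g; rewrite inE.
rewrite (eq_bigl [predU J & ~: J]); last by move=> g; rewrite !inE.
rewrite bigU /=; last by rewrite -setI_eq0 setICr.
rewrite scalerAl; move: (~: J) => J'.
elim: {J'}#|J'| {-2}J' (erefl #|J'|) => [|n IHn] J'.
  by move/cards0_eq => ->; rewrite big_set0 mulr1.
move=> cJ'; have [g gJ'] : exists g, g \in J'.
  by apply/set0Pn; rewrite -cards_eq0 cJ'.
rewrite [X in _ * X](bigD1 g) //= [X in _ * X]mulrC mulrA.
move/polyOver_Aint_div_XsubC => h; apply: (IHn (J' :\ g)).
  by move: cJ'; rewrite (cardsD1 g) gJ' => -[].
by congr (_ * _ \is a _): h; apply: eq_bigl => i; rewrite !inE andbC.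
Qed.

Section IntegerSpan.

Variable K : zmodType.

(** Inductive, so that a multilinear expression can be expanded by induction on each argument. There
    is no constructor for zero, hence the [n.+1] in [zspan_mulrn]. *)
Inductive zspan (P : K -> Prop) : K -> Prop :=
| zspan_gen z : P z -> zspan P z
| zspan_add z1 z2 : zspan P z1 -> zspan P z2 -> zspan P (z1 + z2)
| zspan_opp z : zspan P z -> zspan P (- z).

Lemma zspan_mulrn (P : K -> Prop) z n : zspan P z -> zspan P (z *+ n.+1).
Proof.
by move=> Pz; elim: n => // n IHn; rewrite mulrS; apply: zspan_add.
Qed.

End IntegerSpan.

(** The product is multilinear and is expanded one factor at a time. [P] depends on [g] because
    every conjugate has its own generators. *)
Lemma prod_zspan_Aint (G : finType) (c : algC) (P : G -> algC -> Prop) :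
  (forall w : G -> algC, (forall g, P g (w g)) -> c * \prod_g w g \in Aint) ->
  forall w : G -> algC, (forall g, zspan (P g) (w g)) ->
    c * \prod_g w g \in Aint.
Proof.
move=> genP w wP.
(* [r] lists the positions that may still hold a combination; off [r] the factors are generators. *)
suff: forall (r : seq G) (w' : G -> algC), (forall g, zspan (P g) (w' g)) ->
    (forall g, g \notin r -> P g (w' g)) -> c * \prod_g w' g \in Aint.
  by move=> /(_ (enum G) w wP); apply=> g; rewrite mem_enum.
clear w wP; elim=> [|g r IHr] w wP wr; first by apply: genP => g; apply: wr.
pose upd z h := if h == g then z else w h.
have updE z : \prod_h upd z h = z * \prod_(h | h != g) w h.
  rewrite (bigD1 g) //= /upd eqxx; congr (_ * _).
  by apply: eq_bigr => h /negPf ->.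
have -> : \prod_h w h = \prod_h upd (w g) h.
  by apply: eq_bigr => h _; rewrite /upd; case: eqP => // ->.
elim: {wP}(wP g) (wP) => [z Pz|z1 z2 _ IH1 _ IH2|z _ IH] wP.
- apply: IHr => h; rewrite /upd; case: eqP => [-> //|/eqP hg].
  + exact: zspan_gen.
  + exact: wP.
  + by move=> hr; apply: wr; rewrite inE negb_or hg.
- have := rpredD (IH1 wP) (IH2 wP).
  by rewrite !updE -mulrDr -mulrDl.
- have := IH wP; rewrite !updE mulNr mulrN; exact: rpredNr.
Qed.

(** * Archimedean factors of the height *)

Section MaxOneNorm.

(** This is max (1, |z|), by cases because the order of [algC] is partial. *)
Definition norm1 (z : algC) : algC := if `|z| <= 1 then 1 else `|z|.

Lemma norm1_ge1 z : 1 <= norm1 z.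
Proof.
by rewrite /norm1; case: ifP => // /negbT; rewrite -real_ltNge ?normr_real // => /ltW.
Qed.

Lemma norm1_gt0 z : 0 < norm1 z.
Proof. exact: lt_le_trans ltr01 (norm1_ge1 z). Qed.

Lemma norm1_ge0 z : 0 <= norm1 z.
Proof. exact/ltW/norm1_gt0. Qed.

Lemma le_norm1 z : `|z| <= norm1 z.
Proof. by rewrite /norm1; case: ifP. Qed.

Lemma norm1_le z c : 1 <= c -> `|z| <= c -> norm1 z <= c.
Proof. by rewrite /norm1; case: ifP. Qed.

Lemma norm1M z1 z2 : norm1 (z1 * z2) <= norm1 z1 * norm1 z2.
Proof.
apply: norm1_le; first by rewrite mulr_ege1 ?norm1_ge1.
by rewrite normrM ler_pM ?normr_ge0 ?le_norm1.
Qed.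

Lemma norm1D z1 z2 : norm1 (z1 + z2) <= 2 * (norm1 z1 * norm1 z2).
Proof.
have h1 : 1 <= norm1 z1 * norm1 z2 by rewrite mulr_ege1 ?norm1_ge1.
apply: norm1_le; first by rewrite mulr_ege1 // ler1n.
apply: le_trans (ler_normD _ _) _; rewrite mulr_natl mulr2n lerD //.
  by apply: le_trans (le_norm1 _) _; rewrite ler_peMr ?norm1_ge0 ?norm1_ge1.
by apply: le_trans (le_norm1 _) _; rewrite ler_peMl ?norm1_ge0 ?norm1_ge1.
Qed.

Lemma norm1_sqr z : norm1 (z ^+ 2) = norm1 z ^+ 2.
Proof.
rewrite /norm1 normrX; case: (boolP (`|z| <= 1)) => h.
  by rewrite expr_le1 // h expr1n.
by rewrite expr_le1 // (negPf h).
Qed.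

Lemma norm1V z : z != 0 -> `|z| * norm1 z^-1 = norm1 z.
Proof.
move=> nz; have z_gt0 : 0 < `|z| by rewrite normr_gt0.
have iE : (`|z|^-1 <= 1) = (1 <= `|z|) by rewrite invf_le1.
rewrite /norm1 normfV iE; case: (real_ltgtP (normr_real z) (@real1 algC)) => h.
- by rewrite mulfV // gt_eqF.
- by rewrite mulr1.
- by rewrite h mulr1.
Qed.

Lemma norm1N z : norm1 (- z) = norm1 z.
Proof. by rewrite /norm1 normrN. Qed.

Lemma norm1_1 : norm1 1 = 1.
Proof. by rewrite /norm1 normr1 lexx. Qed.

End MaxOneNorm.

Lemma polyOver_Crat_den (p : {poly algC}) : p \is a polyOver Crat ->
  exists n, (0 < n)%N && (n%:R *: p \is a polyOver Num.int).
Proof.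
move=> /polyOverP pQ.
have [q Dq] : exists q : {poly rat}, p = map_poly ratr q.
  exists (\poly_(i < size p) getCrat p`_i); apply/polyP => i.
  rewrite coef_map coef_poly /=; case: ltnP => [_|?]; first by rewrite getCratK.
  by rewrite nth_default // rmorph0.
have [r [a nz_a Da]] := rat_poly_scale q.
exists `|a|%N; rewrite absz_gt0 nz_a /=; apply/polyOverP => i.
rewrite coefZ Dq Da coef_map /= coefZ coef_map /= rmorphM /= fmorphV /= !ratr_int.
have nz_a' : (a%:~R : algC) != 0 by rewrite intr_eq0.
rewrite mulrA natr_absz; case: (lerP 0 a) => a0.
  by rewrite ger0_norm // mulfV // mul1r rpred_int.
by rewrite ltr0_norm // mulrNz mulNr mulfV // mulN1r rpredN rpred_int.
Qed.

(** * Heights *)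

Section Height.

Variables (L : fieldType) (G : finType) (s : G -> {rmorphism L -> algC}).

(** For the Galois conjugates of [x], a power of its minimal polynomial. *)
Definition conjpoly x : {poly algC} := \prod_g ('X - (s g x)%:P).

Hypothesis conjpoly_rat : forall x, conjpoly x \is a polyOver Crat.

(** Leading coefficient of the primitive integral multiple of [conjpoly x]; it carries the finite
    places of the height. *)
Definition den x : nat := ex_minn (polyOver_Crat_den (conjpoly_rat x)).

Lemma den_gt0 x : (0 < den x)%N.
Proof. by rewrite /den; case: ex_minnP => n /andP[]. Qed.

Lemma den_int x : (den x)%:R *: conjpoly x \is a polyOver Num.int.
Proof. by rewrite /den; case: ex_minnP => n /andP[]. Qed.

Lemma den_min x n : (0 < n)%N -> n%:R *: conjpoly x \is a polyOver Num.int ->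
  (den x <= n)%N.
Proof. by move=> n0 nP; rewrite /den; case: ex_minnP => m _; apply; rewrite n0. Qed.

Lemma den_prod x (J : {set G}) : (den x)%:R * \prod_(g in J) s g x \in Aint.
Proof.
apply: lead_coef_prod_roots_Aint; apply/polyOverP => i.
by apply: Aint_Cint; move/polyOverP: (den_int x).
Qed.

(** The coefficients of [conjpoly x] are signed sums of products of conjugates over subsets, and a
    rational algebraic integer is an integer. With [den_prod], this reduces the comparison of
    denominators to such partial products. *)
Lemma den_le x n : (0 < n)%N ->
  (forall J : {set G}, n%:R * \prod_(g in J) s g x \in Aint) -> (den x <= n)%N.
Proof.
move=> n0 nP; apply: den_min => //; apply/polyOverP => i.
apply: Cint_rat_Aint.
  by rewrite coefZ rpredM ?rpred_nat //; move/polyOverP: (conjpoly_rat x).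
suff: n%:R *: conjpoly x \is a polyOver Aint by move/polyOverP.
rewrite /conjpoly (bigA_distr 1 +%R) /= scaler_sumr rpred_sum // => J _.
rewrite (bigID (mem J)) /=.
rewrite [\prod_(i in J) _](_ : _ = 'X ^+ #|J|); last first.
  by rewrite -prodr_const; apply: eq_bigr => g ->.
rewrite [\prod_(i | i \notin J) _](_ : _ =
  \prod_(g in ~: J) - (s g x)%:P); last first.
  by apply: eq_big => [g|g /negPf -> //]; rewrite inE.
rewrite prodrN -rmorph_prod /= scalerAr rpredM ?rpredX ?polyOverX //.
rewrite scalerAr rpredM ?rpredX ?rpredN ?rpred1 //.
by rewrite -mul_polyC -polyCM polyOverC.
Qed.

Lemma norm_rat x : \prod_g s g x \in Crat.
Proof.
have /polyOverP/(_ 0%N) := conjpoly_rat x.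
rewrite -horner_coef0 horner_prod; under eq_bigr do rewrite hornerXsubC sub0r.
by rewrite prodrN /= rpredMsign.
Qed.

(** A nonzero rational algebraic integer is a nonzero integer. This lower bound yields the
    contradiction in [height_small_relation]. *)
Lemma norm_ge1 x n : x != 0 -> (0 < n)%N -> n%:R * \prod_g s g x \in Aint ->
  1 <= n%:R * \prod_g `|s g x|.
Proof.
move=> nz_x n0 xA.
have Nint : n%:R * \prod_g s g x \in Num.int.
  by apply: Cint_rat_Aint => //; rewrite rpredM ?rpred_nat ?norm_rat.
have := norm_intr_ge1 Nint; rewrite normrM normr_nat normr_prod; apply.
rewrite mulf_neq0 ?pnatr_eq0 -?lt0n //; apply/prodf_neq0 => g _.
by rewrite fmorph_eq0.
Qed.

(** Mahler measure of the primitive integral multiple of [conjpoly x]. It is not normalized by the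
    degree, so absolute constants appear below with exponent [#|G|]. *)
Definition height x : algC := (den x)%:R * \prod_g norm1 (s g x).

Lemma prod_norm1_ge1 x : 1 <= \prod_g norm1 (s g x).
Proof. by elim/big_ind: _ => // [a b|g _]; [apply: mulr_ege1|apply: norm1_ge1]. Qed.

Lemma height_ge1 x : 1 <= height x.
Proof. by rewrite mulr_ege1 ?prod_norm1_ge1 // ler1n den_gt0. Qed.

Lemma height_gt0 x : 0 < height x.
Proof. exact: lt_le_trans ltr01 (height_ge1 x). Qed.

Lemma heightM x y : height (x * y) <= height x * height y.
Proof.
rewrite /height mulrACA -natrM; apply: ler_pM => //.
- exact: le_trans ler01 (prod_norm1_ge1 _).
- rewrite ler_nat; apply: den_le; first by rewrite muln_gt0 !den_gt0.
  move=> J; under eq_bigr do rewrite rmorphM.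
  by rewrite big_split natrM mulrACA rpredM ?den_prod.
- rewrite -big_split /=; apply: ler_prod => g _.
  by rewrite norm1_ge0 rmorphM norm1M.
Qed.

Lemma heightD x y : height (x + y) <= 2 ^+ #|G| * (height x * height y).
Proof.
rewrite /height [X in _ <= _ * X]mulrACA -natrM [X in _ <= X]mulrCA.
apply: ler_pM => //.
- exact: le_trans ler01 (prod_norm1_ge1 _).
- rewrite ler_nat; apply: den_le; first by rewrite muln_gt0 !den_gt0.
  move=> J; pose w g := if g \in J then s g x + s g y else 1.
  have -> : \prod_(g in J) s g (x + y) = \prod_g w g.
    by rewrite big_mkcond; apply: eq_bigr => g _; rewrite /w rmorphD.
  pose P g z := if g \in J then z = s g x \/ z = s g y else z = 1.
  apply: (@prod_zspan_Aint _ _ P) => [v vP|g]; last first.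
    rewrite /w /P; case: ifP => _; last exact: zspan_gen.
    by apply: zspan_add; apply: zspan_gen; [left | right].
  (* The positions of [J] where the expanded product has the conjugate of [x]; at the others it has
     that of [y]. *)
  pose I := [set g in J | v g == s g x].
  have -> : \prod_g v g = \prod_(g in I) s g x * \prod_(g in J :\: I) s g y.
    rewrite [\prod_(g in I) _]big_mkcond [\prod_(g in _ :\: _) _]big_mkcond.
    rewrite -big_split; apply: eq_bigr => g _ /=; have := vP g; rewrite /P !inE.
    case: (g \in J) => /=; last by move->; rewrite mulr1.
    case: (v g =P s g x) => [-> _|wx [//|->]]; by rewrite ?mulr1 ?mul1r.
  by rewrite natrM mulrACA rpredM ?den_prod.
- rewrite -big_split /= -prodr_const -big_split /=; apply: ler_prod => g _.
  by rewrite norm1_ge0 rmorphD norm1D.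
Qed.

Lemma heightN x : height (- x) <= height x.
Proof.
rewrite /height; apply: ler_pM => //.
- exact: le_trans ler01 (prod_norm1_ge1 _).
- rewrite ler_nat; apply: den_le; first by rewrite den_gt0.
  move=> J; under eq_bigr do rewrite rmorphN.
  by rewrite prodrN mulrCA rpredMsign den_prod.
- by apply: ler_prod => g _; rewrite norm1_ge0 rmorphN norm1N lexx.
Qed.

Lemma height1 : height 1 <= 1.
Proof.
rewrite /height big1 ?mulr1 => [|g _]; last by rewrite rmorph1 norm1_1.
rewrite lern1; apply: den_le => // J.
by rewrite mul1r big1 // => g _; rewrite rmorph1.
Qed.

(** Up to sign [N] is the constant coefficient of the primitive polynomial of [x], and the inverse
    is a root of the reversed polynomial: [N] times a product of inverses over [J] is [den x] times
    the product of conjugates over the complement. *)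
Lemma heightV x : x != 0 -> height x^-1 <= height x.
Proof.
move=> nz_x; pose N := (den x)%:R * \prod_g s g x.
have nz_s g : s g x != 0 by rewrite fmorph_eq0.
have Nint : N \in Num.int.
  apply: Cint_rat_Aint; first by rewrite rpredM ?rpred_nat ?norm_rat.
  suff -> : N = (den x)%:R * \prod_(g in [set: G]) s g x by apply: den_prod.
  by congr (_ * _); apply: eq_bigl => g; rewrite inE.
have [m Dm] : exists m : nat, `|N| = m%:R.
  by have /natrP[m ->] := natr_norm_int Nint; exists m.
have NE : `|N| = (den x)%:R * \prod_g `|s g x|.
  by rewrite normrM normr_nat normr_prod.
have m_gt0 : (0 < m)%N.
  rewrite -(ltr_nat algC) -Dm normr_gt0 mulf_neq0 //.
    by rewrite pnatr_eq0 -lt0n den_gt0.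
  by apply/prodf_neq0 => g _.
have mA (z : algC) : N * z \in Aint -> m%:R * z \in Aint.
  rewrite -Dm; have /intrP[k ->] := Nint; rewrite -intr_norm.
  case: (lerP 0 k) => k0; first by rewrite ger0_norm.
  by rewrite ltr0_norm // mulrNz mulNr rpredN.
rewrite /height; apply: (@le_trans _ _ (m%:R * \prod_g norm1 (s g x^-1))).
  rewrite ler_wpM2r //; first exact: le_trans ler01 (prod_norm1_ge1 _).
  rewrite ler_nat; apply: den_le => // J; apply: mA.
  suff -> : N * \prod_(g in J) s g x^-1 = (den x)%:R * \prod_(g in ~: J) s g x.
    exact: den_prod.
  rewrite /N -mulrA; congr (_ * _).
  rewrite (bigID (mem J)) /= mulrAC -big_split /= big1 => [|g _]; last first.
    by rewrite fmorphV mulfV.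
  by rewrite mul1r; apply: eq_bigl => g; rewrite inE.
rewrite -Dm NE -mulrA -big_split /=.
apply: ler_wpM2l; rewrite ?ler0n //; apply: ler_prod => g _.
rewrite fmorphV norm1V // norm1_ge0 lexx //.
Qed.

End Height.

Section HeightGap.

Variables (L : fieldType) (G : finType) (s : G -> {rmorphism L -> algC}).
Hypothesis conjpoly_rat : forall x, conjpoly s x \is a polyOver Crat.
Local Notation den := (den conjpoly_rat).
Local Notation height := (height conjpoly_rat).

(** Gauss's lemma for the identity a^2 f2(X^2) = b f(X) f(-X), valid up to sign: the right side has
    content b because [f] is primitive, and the content of the left side is a multiple of a^2. *)
Lemma den_sqr x : (den x ^ 2 <= den (x ^+ 2))%N.
Proof.
have monC y : conjpoly s y \is monic by apply: monic_prod_XsubC.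
have [/floorpP[f Df] /floorpP[f2 Df2]] := (den_int conjpoly_rat x, den_int conjpoly_rat (x ^+ 2)).
set a := den x in Df *; set b := den (x ^+ 2) in Df2 *.
have a0 : (0 < a)%N := den_gt0 _ _; have b0 : (0 < b)%N := den_gt0 _ _.
pose Zi := map_poly (intr : int -> algC).
have Zinj : injective Zi by apply: map_inj_poly; [apply: intr_inj | rewrite rmorph0].
have lead_f : lead_coef f = a.
  apply: (@intr_inj algC); rewrite -(@lead_coef_map_inj _ _ intr) //; last exact: intr_inj.
  by rewrite -Df lead_coefZ (monicP (monC x)) mulr1.
(* Dividing [f] by a content k > 1 would give a denominator smaller than [a], which is the least. *)
have cf1 : zcontents f = 1.
  have Dz := zpolyEprim f.
  have c_gt0 : 0 < zcontents f by rewrite -sgz_gt0 sgz_contents sgz_gt0 lead_f.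
  case Dk: (zcontents f) c_gt0 => [k|//] k_gt0; rewrite Dk in Dz.
  have lead_z : a%:Z = k%:Z * lead_coef (zprimitive f).
    by rewrite -lead_f {1}Dz lead_coefZ.
  case De: (lead_coef (zprimitive f)) lead_z => [e|e]; last by nia.
  move=> lead_z; have ake : a = (k * e)%N by apply/eqP; rewrite -eqz_nat lead_z.
  have : (a <= e)%N.
    apply: den_min; first by nia.
    suff -> : e%:R *: conjpoly s x = Zi (zprimitive f).
      by apply/polyOverP => i; rewrite coef_map /= rpred_int.
    have nz_k : (k%:R : algC) != 0 by rewrite pnatr_eq0; lia.
    apply: (scalerI nz_k); rewrite scalerA -natrM -ake Df {1}Dz map_polyZ /=.
    by [].
  by move: k_gt0; rewrite ake => ? ?; congr Posz; nia.
have Df2s : (a ^ 2)%:R *: (f2 \Po 'X^2) =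
            ((-1) ^+ #|G| * b%:R) *: (f * (f \Po - 'X)).
  have Zcomp p q : Zi (p \Po q) = Zi p \Po Zi q by apply: map_comp_poly.
  have ZM p q : Zi (p * q) = Zi p * Zi q by apply: rmorphM.
  have ZZ c p : Zi (c *: p) = c%:~R *: Zi p by apply: map_polyZ.
  have ZN p : Zi (- p) = - Zi p by apply: rmorphN.
  have ZX : Zi 'X = 'X by apply: map_polyX.
  have ZX2 : Zi 'X^2 = 'X^2 by apply: map_polyXn.
  apply: Zinj; rewrite !(ZZ, ZM, Zcomp, ZN, ZX, ZX2).
  rewrite [Zi f](esym Df) [Zi f2](esym Df2).
  rewrite !comp_polyZ -scalerAl -!scalerAr !scalerA.
  have -> : conjpoly s (x ^+ 2) \Po 'X^2 =
      (-1) ^+ #|G| *: (conjpoly s x * (conjpoly s x \Po - 'X)).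
    rewrite /conjpoly !rmorph_prod /= -big_split /=.
    rewrite -[(-1) ^+ _]prodr_const -scaler_prod; apply: eq_bigr => g _.
    rewrite !comp_polyB !comp_polyX !comp_polyC rmorphXn /= polyCM.
    by rewrite scaleN1r expr2; ring.
  rewrite !scalerA; congr (_ *: _).
  by rewrite !(intrM, rmorph_nat, rmorphXn, rmorphN1) /=; ring.
(* The substitution of -X is an involution, hence preserves primitivity; the content may change
   sign. *)
have c'1 : `|zcontents (f \Po - 'X)| = 1.
  have Dg := zpolyEprim (f \Po - 'X).
  have Dff : f = zcontents (f \Po - 'X) *: (zprimitive (f \Po - 'X) \Po - 'X).
    rewrite -comp_polyZ -Dg -comp_polyA rmorphN /= comp_polyX.
    by rewrite opprK comp_polyXr.
  have := congr1 zcontents Dff; rewrite zcontentsZ cf1.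
  move=> /(congr1 absz); rewrite abszM /= => /esym/eqP.
  by rewrite muln_eq1 => /andP[/eqP h _]; rewrite -abszE h.
move: Df2s => /(congr1 zcontents); rewrite !zcontentsZ zcontentsM cf1.
move: (zcontents (f \Po - 'X)) c'1 (zcontents (f2 \Po 'X^2)) => c' c'1 c.
move=> /(congr1 Num.norm); rewrite !normrM normrX normrN1 expr1n c'1 normr1.
rewrite !mul1r !mulr1 !normr_nat.
have [->|nz_c] := eqVneq c 0; nia.
Qed.

(** With [heightM] this is an equality, so that heights of powers with exponent 2^q are known
    exactly. *)
Lemma height_sqr x : height x ^+ 2 <= height (x ^+ 2).
Proof.
rewrite exprMn -natrX -prodrXl; apply: ler_pM => //.
- by apply: prodr_ge0 => g _; rewrite exprn_ge0 ?norm1_ge0.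
- by rewrite ler_nat den_sqr.
- by apply: ler_prod => g _; rewrite exprn_ge0 ?norm1_ge0 //= rmorphXn norm1_sqr.
Qed.

(* Two solutions of x - y = 1 determine each other from their quotient by
   Cramer's rule, so the quotient cannot be much simpler than the solutions. *)
Lemma height_gap x x' : x != 0 -> x - 1 != 0 -> x' != 0 -> x' - 1 != 0 ->
  x != x' ->
  height x * height (x - 1) <=
    16 ^+ #|G| * (height (x' / x) * height ((x' - 1) / (x - 1))) ^+ 3.
Proof.
move=> nx ny nx' ny' dx; set u := x' / x; set v := (x' - 1) / (x - 1).
have dx' : x' - x != 0 by rewrite subr_eq0 eq_sym.
have Duv : u - v = (x - x') / (x * (x - 1)).
  by rewrite /u /v; field; rewrite nx ny.
have nuv : u - v != 0.
  by rewrite Duv mulf_neq0 ?invr_eq0 ?mulf_neq0 // subr_eq0.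
have nd : x - x' != 0 by rewrite subr_eq0.
have Dx : x = (1 - v) / (u - v).
  by rewrite Duv /v; field; rewrite nx ny nd.
have Dy : x - 1 = (1 - u) / (u - v).
  by rewrite Duv /u; field; rewrite nx ny nd.
have ge0 w : 0 <= height w by apply/ltW/height_gt0.
have h1 w : height (1 - w) <= 2 ^+ #|G| * height w.
  apply: le_trans (heightD _ _ _) _; apply: ler_wpM2l; first exact: exprn_ge0.
  by rewrite -[leRHS]mul1r; apply: ler_pM; [exact: ge0|exact: ge0|exact: height1|exact: heightN].
have huv : height (u - v)^-1 <= 2 ^+ #|G| * (height u * height v).
  apply: le_trans (heightV _ nuv) _; apply: le_trans (heightD _ _ _) _.
  apply: ler_wpM2l; first exact: exprn_ge0.
  by apply: ler_wpM2l; [exact: ge0|exact: heightN].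
(* Numerator and denominator cost [2 ^+ #|G|] each, for [x] and for [x - 1]; hence 16 = 2^4. *)
have -> : 16 ^+ #|G| * (height u * height v) ^+ 3 =
  (2 ^+ #|G| * height v * (2 ^+ #|G| * (height u * height v))) *
  (2 ^+ #|G| * height u * (2 ^+ #|G| * (height u * height v))).
  have -> : 16 ^+ #|G| = (2 ^+ #|G|) ^+ 4 :> algC.
    by rewrite -exprM mulnC exprM; congr (_ ^+ _); rewrite -natrX.
  by move: (2 ^+ _) (height u) (height v) => e h k; ring.
rewrite {1}Dx Dy.
apply: ler_pM; [exact: ge0|exact: ge0| |].
  apply: (le_trans (heightM _ _ _)).
  by apply: ler_pM; [exact: ge0|exact: ge0|exact: h1|exact: huv].
apply: (le_trans (heightM _ _ _)).
by apply: ler_pM; [exact: ge0|exact: ge0|exact: h1|exact: huv].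
Qed.

End HeightGap.

(** * Solutions whose quotients have very small height *)

Section SmallHeight.

Variables (L : fieldType) (G : finType) (s : G -> {rmorphism L -> algC}).
Hypothesis conjpoly_rat : forall x, conjpoly s x \is a polyOver Crat.
Local Notation den := (den conjpoly_rat).
Local Notation height := (height conjpoly_rat).

Section Monomials.

Variables u1 v1 u2 v2 : L.

(** With boolean exponents, each of the four numbers contributes to a product over all conjugates a
    product over a subset, to which [den_prod] applies. *)
Definition monom1 (z : L) : Prop := exists e : bool * bool * bool * bool,
  z = u1 ^+ e.1.1.1 * v1 ^+ e.1.1.2 * u2 ^+ e.1.2 * v2 ^+ e.2.

Fixpoint monom n (z : L) : Prop :=
  if n is k.+1 then exists a b, [/\ monom1 a, monom k b & z = a * b]
  else z = 1.

Lemma monomM n k a b : monom n a -> monom k b -> monom (n + k) (a * b).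
Proof.
elim: n a => [|n IHn] a /=; first by move=> ->; rewrite mul1r.
move=> [a1 [a2 [m1 ma ->]]] mb; exists a1, (a2 * b); split=> //.
  exact: IHn.
by rewrite mulrA.
Qed.

Lemma zspan_monomM n k a b : zspan (monom n) a -> zspan (monom k) b ->
  zspan (monom (n + k)) (a * b).
Proof.
move=> az bz; elim: az => [z mz|z1 z2 _ IH1 _ IH2|z _ IH].
- elim: bz => [w mw|w1 w2 _ IH1 _ IH2|w _ IH].
  + by apply: zspan_gen; apply: monomM.
  + by rewrite mulrDr; apply: zspan_add.
  + by rewrite mulrN; apply: zspan_opp.
- by rewrite mulrDl; apply: zspan_add.
- by rewrite mulNr; apply: zspan_opp.
Qed.

Lemma zspan_monomX n a : zspan (monom 1) a -> zspan (monom n) (a ^+ n).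
Proof.
move=> az; elim: n => [|n IHn]; first by rewrite expr0; apply: zspan_gen.
by rewrite exprS -add1n; apply: zspan_monomM.
Qed.

(** The Frobenius defect ((a + b)^7 - a^7 - b^7) / 7. Exponents 1 are written out so that every term
    has the form a^i b^j with i + j = 7. *)
Definition frob7 (a b : L) : L :=
  a ^+ 6 * b ^+ 1 + a ^+ 5 * b ^+ 2 *+ 3 + a ^+ 4 * b ^+ 3 *+ 5
  + a ^+ 3 * b ^+ 4 *+ 5 + a ^+ 2 * b ^+ 5 *+ 3 + a ^+ 1 * b ^+ 6.

Lemma frob7E a b : (a + b) ^+ 7 = a ^+ 7 + b ^+ 7 + frob7 a b *+ 7.
Proof. by rewrite /frob7; ring. Qed.

Lemma zspan_frob7 a b : zspan (monom 1) a -> zspan (monom 1) b ->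
  zspan (monom 7) (frob7 a b).
Proof.
move=> az bz.
have h i j : (i + j = 7)%N -> zspan (monom 7) (a ^+ i * b ^+ j).
  by move=> <-; apply: zspan_monomM; apply: zspan_monomX.
by rewrite /frob7; do !apply: zspan_add; do ?apply: zspan_mulrn; apply: h.
Qed.

(** The monomial varies with the conjugate, as it does after the multilinear expansion of a norm. *)
Lemma den_monom n (w : G -> L) : (forall g, monom n (w g)) ->
  ((den u1 * den v1 * den u2 * den v2) ^ n)%:R * \prod_g s g (w g) \in Aint.
Proof.
elim: n w => [|n IHn] w wP.
  by rewrite big1 ?mulr1 // => g _; rewrite wP rmorph1.
have /fin_all_exists[a aP] : forall g, exists a, exists b,
    [/\ monom1 a, monom n b & w g = a * b] by [].
have /fin_all_exists[b bP] := aP.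
have -> : \prod_g s g (w g) = \prod_g s g (a g) * \prod_g s g (b g).
  by rewrite -big_split; apply: eq_bigr => g _; have [_ _ ->] := bP g; rewrite rmorphM.
rewrite expnS natrM mulrACA rpredM //; last by apply: IHn => g; have [] := bP g.
have /fin_all_exists[e eP] : forall g, monom1 (a g) by move=> g; have [] := bP g.
have pr (x : L) (E : G -> bool) :
    \prod_g s g x ^+ E g = \prod_(g in [set g | E g]) s g x.
  rewrite [RHS]big_mkcond; apply: eq_bigr => g _.
  by rewrite inE; case: (E g); rewrite ?expr1 ?expr0.
have -> : \prod_g s g (a g) =
    \prod_(g in [set g | (e g).1.1.1]) s g u1 *
    \prod_(g in [set g | (e g).1.1.2]) s g v1 *
    \prod_(g in [set g | (e g).1.2]) s g u2 *
    \prod_(g in [set g | (e g).2]) s g v2.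
  rewrite -!pr -!big_split; apply: eq_bigr => g _.
  by rewrite eP !rmorphM !rmorphXn.
rewrite !natrM mulrACA; apply: rpredM; last exact: den_prod.
rewrite mulrACA; apply: rpredM; last exact: den_prod.
by rewrite mulrACA; apply: rpredM; apply: den_prod.
Qed.

(* The seventh powers satisfy the relation up to a factor 7 (Frobenius); if
   they did not satisfy it exactly, the norm of the defect divided by 7 would
   be too small once 7 exceeds the number 6 of terms. *)
Lemma height_small_relation :
  (u1 - 1) * (v2 - 1) = (u2 - 1) * (v1 - 1) ->
  6 ^+ #|G| * (height u1 * height v1 * height u2 * height v2) ^+ 7 < 7 ^+ #|G| ->
  (u1 ^+ 7 - 1) * (v2 ^+ 7 - 1) = (u2 ^+ 7 - 1) * (v1 ^+ 7 - 1).
Proof.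
move=> rel small.
have mon (e : bool * bool * bool * bool) : zspan (monom 1)
    (u1 ^+ e.1.1.1 * v1 ^+ e.1.1.2 * u2 ^+ e.1.2 * v2 ^+ e.2).
  apply: zspan_gen => /=; eexists; exists 1; split; [by exists e|by []|].
  by rewrite mulr1.
(* The six signed terms of the expanded relation; they add up to 0. *)
pose m1 := u1 * v2; pose m2 := - u1; pose m3 := - v2.
pose m4 := - (u2 * v1); pose m5 := u2; pose m6 := v1.
have z1 : zspan (monom 1) m1.
  by have := mon (true, false, false, true); rewrite /= !expr1 !expr0 !mulr1.
have z2 : zspan (monom 1) m2.
  by have := mon (true, false, false, false); rewrite /= !expr1 !expr0 !mulr1; apply: zspan_opp.
have z3 : zspan (monom 1) m3.
  by have := mon (false, false, false, true); rewrite /= !expr1 !expr0 !mul1r; apply: zspan_opp.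
have z4 : zspan (monom 1) m4.
  have := mon (false, true, true, false); rewrite /= !expr1 !expr0 !mulr1 !mul1r mulrC.
  exact: zspan_opp.
have z5 : zspan (monom 1) m5.
  by have := mon (false, false, true, false); rewrite /= !expr1 !expr0 !mulr1 !mul1r.
have z6 : zspan (monom 1) m6.
  by have := mon (false, true, false, false); rewrite /= !expr1 !expr0 !mulr1 !mul1r.
(* The defects collected while the six terms are added one at a time. *)
pose D := frob7 m1 m2 + frob7 (m1 + m2) m3 + frob7 (m1 + m2 + m3) m4 +
          frob7 (m1 + m2 + m3 + m4) m5 + frob7 (m1 + m2 + m3 + m4 + m5) m6.
have zD : zspan (monom 7) D.
  have s2 := zspan_add z1 z2; have s3 := zspan_add s2 z3.
  have s4 := zspan_add s3 z4; have s5 := zspan_add s4 z5.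
  apply: zspan_add (zspan_frob7 s5 z6); apply: zspan_add (zspan_frob7 s4 z5).
  apply: zspan_add (zspan_frob7 s3 z4); apply: zspan_add (zspan_frob7 s2 z3).
  exact: zspan_frob7 z1 z2.
(* The relation for seventh powers, expanded. Signs survive because 7 is odd. *)
pose F := u1 ^+ 7 * v2 ^+ 7 - u1 ^+ 7 - v2 ^+ 7 - u2 ^+ 7 * v1 ^+ 7 + u2 ^+ 7 + v1 ^+ 7.
have FD : F = - (D *+ 7).
  have sum0 : m1 + m2 + m3 + m4 + m5 + m6 = 0.
    by rewrite /m1 /m2 /m3 /m4 /m5 /m6;
      transitivity ((u1 - 1) * (v2 - 1) - (u2 - 1) * (v1 - 1)); [ring | rewrite rel subrr].
  have : (m1 + m2 + m3 + m4 + m5 + m6) ^+ 7 = F + D *+ 7.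
    have e7 : m1 ^+ 7 + m2 ^+ 7 + m3 ^+ 7 + m4 ^+ 7 + m5 ^+ 7 + m6 ^+ 7 = F.
      by rewrite /F /m1 /m2 /m3 /m4 /m5 /m6; ring.
    rewrite -e7 /D 5!frob7E.
    by ring.
  by rewrite sum0 expr0n /= => /esym/eqP; rewrite addr_eq0 => /eqP.
have [D0|nz_D] := eqVneq D 0.
  apply/eqP; rewrite -subr_eq0; apply/eqP; transitivity F; first by rewrite /F; ring.
  by rewrite FD D0 mul0rn oppr0.
pose b := (den u1 * den v1 * den u2 * den v2)%N.
have DA : (b ^ 7)%:R * \prod_g s g D \in Aint.
  apply: (@prod_zspan_Aint _ _ (fun g z => exists2 w, monom 7 w & z = s g w)).
    move=> w /fin_all_exists2[v vP wv].
    by under eq_bigr do rewrite wv; apply: den_monom.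
  move=> g; elim: zD => [z mz|a1 a2 _ IH1 _ IH2|z _ IH].
  - by apply: zspan_gen; exists z.
  - by rewrite rmorphD; apply: zspan_add.
  - by rewrite rmorphN; apply: zspan_opp.
have b_gt0 : (0 < b)%N by rewrite !muln_gt0 !den_gt0.
have b7_gt0 : (0 < b ^ 7)%N by rewrite expn_gt0 b_gt0.
have ge1 := norm_ge1 conjpoly_rat nz_D b7_gt0 DA.
pose M g := norm1 (s g u1) * norm1 (s g v1) * norm1 (s g u2) * norm1 (s g v2).
have bound g : `|s g D| *+ 7 <= 6 * M g ^+ 7.
  have -> : `|s g D| *+ 7 = `|s g F|.
    by rewrite FD rmorphN rmorphMn normrN normrMn.
  have [n1 n2 n3 n4] := And4 (norm1_ge1 (s g u1)) (norm1_ge1 (s g v1))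
                             (norm1_ge1 (s g u2)) (norm1_ge1 (s g v2)).
  have [l1 l2 l3 l4] := And4 (le_norm1 (s g u1)) (le_norm1 (s g v1))
                             (le_norm1 (s g u2)) (le_norm1 (s g v2)).
  have pw z c : `|z| <= c -> c <= M g -> `|z ^+ 7| <= M g ^+ 7.
    by move=> zc cM; rewrite normrX; apply: lerXn2r; rewrite ?nnegrE //;
       [apply: le_trans cM; apply: le_trans zc | apply: le_trans zc cM].
  have ge0 c : 1 <= c -> 0 <= c :> algC by apply: le_trans.
  have p1 : `|s g u1 ^+ 7| <= M g ^+ 7.
    by apply: (pw _ _ l1); rewrite /M -!mulrA ler_peMr ?ge0 // !mulr_ege1.
  have p2 : `|s g v1 ^+ 7| <= M g ^+ 7.
    apply: (pw _ _ l2); rewrite /M (mulrC (norm1 (s g u1))) -!mulrA.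
    by rewrite ler_peMr ?ge0 // !mulr_ege1.
  have p3 : `|s g u2 ^+ 7| <= M g ^+ 7.
    apply: (pw _ _ l3); rewrite /M mulrAC mulrC.
    by rewrite ler_peMr ?ge0 // !mulr_ege1.
  have p4 : `|s g v2 ^+ 7| <= M g ^+ 7.
    apply: (pw _ _ l4); rewrite /M mulrC.
    by rewrite ler_peMr ?ge0 // !mulr_ege1.
  have p14 : `|s g u1 ^+ 7 * s g v2 ^+ 7| <= M g ^+ 7.
    rewrite -exprMn; apply: (pw _ (norm1 (s g u1) * norm1 (s g v2))).
      by rewrite normrM ler_pM.
    rewrite [leRHS](_ : _ = norm1 (s g u1) * norm1 (s g v2) *
       (norm1 (s g v1) * norm1 (s g u2))); last by rewrite /M; ring.
    by rewrite ler_peMr ?ge0 // !mulr_ege1.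
  have p23 : `|s g u2 ^+ 7 * s g v1 ^+ 7| <= M g ^+ 7.
    rewrite -exprMn; apply: (pw _ (norm1 (s g u2) * norm1 (s g v1))).
      by rewrite normrM ler_pM.
    rewrite [leRHS](_ : _ = norm1 (s g u2) * norm1 (s g v1) *
       (norm1 (s g u1) * norm1 (s g v2))); last by rewrite /M; ring.
    by rewrite ler_peMr ?ge0 // !mulr_ege1.
  rewrite /F !(rmorphD, rmorphN, rmorphM, rmorphXn) /=.
  rewrite (_ : 6 * M g ^+ 7 = M g ^+ 7 + M g ^+ 7 + M g ^+ 7 + M g ^+ 7 + M g ^+ 7 + M g ^+ 7); last by ring.
  do 5!(apply: le_trans (ler_normD _ _) _; apply: lerD; rewrite ?normrN //).
suff : 7 ^+ #|G| <= 6 ^+ #|G| * (height u1 * height v1 * height u2 * height v2) ^+ 7.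
  by move=> h; have := lt_le_trans small h; rewrite ltxx.
have -> : height u1 * height v1 * height u2 * height v2 = b%:R * \prod_g M g.
  by rewrite /height /M !big_split /= !natrM; ring.
(* The norm of [D] times b^7 is at least 1 and may be inserted; then 7 |D| is compared with 6 M^7 at
   each conjugate. *)
apply: (@le_trans _ _ (7 ^+ #|G| * ((b ^ 7)%:R * \prod_g `|s g D|))).
  by rewrite ler_peMr // exprn_ge0.
rewrite exprMn natrX !(mulrCA _ (b%:R ^+ 7)) ler_pM2l ?exprn_gt0 ?ltr0n //.
rewrite -!prodr_const -prodrXl -!big_split /=; apply: ler_prod => g _.
by rewrite mulr_ge0 //= mulr_natl.
Qed.

End Monomials.

End SmallHeight.

Section SmallHeightCount.

Variables (L : fieldType) (G : finType) (s : G -> {rmorphism L -> algC}).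
Hypothesis conjpoly_rat : forall x, conjpoly s x \is a polyOver Crat.
Local Notation height := (height conjpoly_rat).

(** By [height_small_relation] the vectors (c x, e x) are pairwise proportional, and x / x0 is an
    affine function of v x; so all v x are roots of one polynomial of degree at most 7. The exponent
    is 14 because two quotients, each bounded by [rho], enter with power 7. *)
Lemma height_cluster (x0 : L) (X : seq L) (rho : algC) :
  7%:R != 0 :> L -> x0 != 0 -> x0 - 1 != 0 -> uniq X ->
  {in X, forall x, height (x / x0) * height ((x - 1) / (x0 - 1)) <= rho} ->
  6 ^+ #|G| * rho ^+ 14 < 7 ^+ #|G| -> (size X <= 7)%N.
Proof.
move=> nz7 nx0 ny0 uX Xrho small.
pose k := (x0 - 1) / x0; pose v x := (x - 1) / (x0 - 1).
have nk : k != 0 by rewrite mulf_neq0 ?invr_eq0.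
have nk1 : 1 - k != 0.
  by rewrite (_ : 1 - k = x0^-1) ?invr_eq0 // /k; field.
have uE x : x / x0 = 1 + k * (v x - 1).
  by rewrite /k /v; field; rewrite nx0 ny0.
have v_inj : injective v by move=> x y /(divIf ny0)/addIr.
have roots_bound (p : {poly L}) : p != 0 -> (size p <= 8)%N ->
    {in X, forall x, p.[v x] = 0} -> (size X <= 7)%N.
  move=> nz_p szp pX; rewrite -(size_map v) -ltnS; apply: leq_trans szp.
  apply: max_poly_roots => //; last by rewrite map_inj_uniq.
  by apply/allP => _ /mapP[x xX ->]; rewrite /root pX.
pose e x := v x ^+ 7 - 1; pose c x := (x / x0) ^+ 7 - 1.
have hp a b : 0 <= height a * height b.
  by apply: mulr_ge0; apply/ltW/height_gt0.
have rel x y : x \in X -> y \in X -> c x * e y = c y * e x.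
  move=> xX yX; apply: (@height_small_relation _ _ _ conjpoly_rat).
    by rewrite !uE; ring.
  have := small; apply: le_lt_trans; rewrite ler_wpM2l ?exprn_ge0 //.
  rewrite -mulrA (_ : 14%N = (2 * 7)%N) // exprM; apply: lerXn2r.
  - by rewrite nnegrE; apply: mulr_ge0; apply: hp.
  - by rewrite nnegrE exprn_ge0 //; apply: le_trans (Xrho _ xX); apply: hp.
  - by rewrite expr2; apply: ler_pM; [exact: hp|exact: hp|exact: Xrho|exact: Xrho].
have sz7 : size ('X^7 - 1 : {poly L}) = 8%N by rewrite -[1]/(1%:P) size_XnsubC.
have [/hasP[y yX nz_y]|/hasPn all0] := boolP (has (fun y => (c y, e y) != (0, 0)) X); last first.
  apply: (roots_bound ('X^7 - 1)) => [||x xX].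
  - by rewrite -size_poly_eq0 sz7.
  - by rewrite sz7.
  - by have /negPn/eqP[_ ex] := all0 x xX; rewrite !hornerE -ex.
pose q : {poly L} := (1 + k *: ('X - 1)) ^+ 7 - 1.
have szq : (size q <= 8)%N.
  apply: leq_trans (size_polyD _ _) _; rewrite geq_max size_polyN size_poly1 andbT.
  apply: leq_trans (size_poly_exp_leq _ _) _; rewrite ltnS.
  have h : (size (1 + k *: ('X - 1) : {poly L})%R <= 2)%N.
    apply: leq_trans (size_polyD _ _) _; rewrite geq_max size_poly1 /=.
    apply: leq_trans (size_scale_leq _ _) _.
    by rewrite -[1]/(1%:P) size_XsubC.
  by move: h; move: (size _) => n hn; lia.
have qE z : q.[z] = (1 + k * (z - 1)) ^+ 7 - 1 by rewrite /q !hornerE.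
apply: (roots_bound (e y *: q - c y *: ('X^7 - 1))).
(* If e y = 0 then c y is nonzero. Otherwise the derivative at 0 is nonzero: X^7 - 1 contributes
   nothing there, and [q] contributes 7 k (1 - k)^6. *)
- have [e0|ne] := eqVneq (e y) 0.
    rewrite e0 scale0r sub0r oppr_eq0 scaler_eq0 negb_or -[in X in _ && X]size_poly_eq0 sz7 andbT.
    by apply: contra nz_y => /eqP ->; rewrite e0.
  apply/eqP => /(congr1 (fun p => p^`().[0])).
  rewrite deriv0 horner0 derivB !derivZ /q !derivB deriv_exp derivXn !derivE /= !hornerE /=.
  rewrite !expr0n /= => /eqP; apply/negP.
  rewrite (_ : _ + _ = 7%:R * (e y * k * (1 - k) ^+ 6)); last by ring.
  apply: mulf_neq0 => //; apply: mulf_neq0; first exact: mulf_neq0.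
  exact: expf_neq0.
- apply: leq_trans (size_polyD _ _) _; rewrite geq_max size_polyN.
  rewrite (leq_trans (size_scale_leq _ _) szq) /=.
  by apply: leq_trans (size_scale_leq _ _) _; rewrite sz7.
- move=> x xX; have := rel x y xX yX; rewrite /c {1}uE /e => r.
  rewrite hornerD hornerN !hornerZ qE !hornerE /= mulrC r mulrC subrr.
  by [].
Qed.

End SmallHeightCount.

(** [L] is the splitting field of a rational polynomial that vanishes on [t], [G] its Galois group
    and [g0] the identity. The coefficients of [conjpoly] are fixed by the group, hence rational. *)
Lemma galois_number_field (t : seq algC) :
  exists (L : fieldType) (G : finType) (s : G -> {rmorphism L -> algC}) (g0 : G)
    (t' : seq L),
  (forall x, conjpoly s x \is a polyOver Crat) /\ map (s g0) t' = t.
Proof.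
have [p nz_p tp] : exists2 p : {poly rat}, p != 0 &
    {in t, forall z, root (map_poly ratr p) z}.
  elim: t => [|z t [p nz_p tp]]; first by exists 1 => //; apply: oner_neq0.
  have [q [Dq mon_q] _] := minCpolyP z.
  exists (p * q) => [|y]; first by rewrite mulf_neq0 // monic_neq0.
  rewrite inE rmorphM rootM => /predU1P[->|/tp -> //].
  by apply/orP; right; have := root_minCpoly z; rewrite Dq.
pose pC : {poly algC} := map_poly ratr p.
have nz_pC : pC != 0 by rewrite map_poly_eq0.
have [r Dr] := closed_field_poly_normal pC.
have nz_l : lead_coef pC != 0 by rewrite lead_coef_eq0.
have [Qr [QrC [rr Drr genQr]]] := num_field_exists r.
pose pr := map_poly (in_alg Qr) p.
have QrC_alg a : QrC (in_alg Qr a) = ratr a.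
  by rewrite in_algE rmorphZ_num rmorph1 mulr1.
have pQ : pr \is a polyOver 1%AS.
  by apply/polyOverP => i; rewrite coef_map memvZ ?mem1v.
have splitQr : splittingFieldFor 1 pr {:Qr}.
  exists rr => //; rewrite -(eqp_map QrC) -map_poly_comp.
  rewrite (eq_map_poly (g := ratr)) => [|a]; last exact: QrC_alg.
  rewrite -/pC Dr rmorph_prod -Drr big_map.
  under [X in _ %= X]eq_bigr do rewrite rmorphB /= map_polyX map_polyC /=.
  by rewrite eqp_scale.
have Qr_ax : FieldExt_isSplittingField _ Qr by constructor; exists pr.
pose M : splittingFieldType rat := HB.pack_for (splittingFieldType rat) Qr Qr_ax.
have galois1 : galois 1 {:M}.
  rewrite /galois subvf normalFieldf andbT /=.
  by apply/separableP => x _; apply: pcharf0_separable => i; rewrite -(fmorph_pchar QrC) pchar_num.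
pose s (g : gal_of {:M}) : {rmorphism M -> algC} :=
  GRing.RMorphism.clone _ _ (QrC \o (gal_repr g : M -> M)) _.
have t_sub z : z \in t -> exists z', QrC z' = z.
  move=> /tp; rewrite -/pC Dr rootZ // root_prod_XsubC -Drr => /mapP[z' _ ->].
  by exists z'.
have [t' Dt'] : exists t', map QrC t' = t.
  elim: t t_sub {tp} => [|z t IHt] tsub; first by exists [::].
  have [z' <-] := tsub z (mem_head _ _).
  have [|t' <-] := IHt; first by move=> y yt; apply: tsub; rewrite inE yt orbT.
  by exists (z' :: t').
exists M, (gal_of {:M}), s, 1%g, t'; split; last first.
  by rewrite -Dt'; apply: eq_map => z /=; rewrite gal_id.
move=> x; pose P : {poly M} := \prod_(g : gal_of {:M}) ('X - (g x)%:P).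
have -> : conjpoly s x = map_poly QrC P.
  rewrite rmorph_prod; apply: eq_bigr => g _.
  by rewrite rmorphB /= map_polyX map_polyC.
apply/polyOverP => i; rewrite coef_map /=.
suff /vlineP[a ->] : P`_i \in (1%VS : {vspace M}) by rewrite -/(in_alg Qr a) QrC_alg Crat_rat.
rewrite -(galois_fixedField galois1); apply/fixedFieldP; first exact: memvf.
move=> h _; rewrite -coef_map /=; congr ((polyseq _)`_i).
rewrite rmorph_prod /= [RHS](reindex_inj (mulIg h)) /=.
by apply: eq_bigr => g _; rewrite rmorphB /= map_polyX map_polyC /= galM ?memvf.
Qed.

(** * Specialization to algebraic numbers *)

Section Specialization.

Variable C : fieldType.

(** A form of the Nullstellensatz for the image of [ev]: [phi] factors through this image and keeps
    one prescribed nonzero element nonzero. *)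
Definition specializable (R : comNzRingType) : Prop :=
  forall (ev : {rmorphism R -> C}) (f : R), ev f != 0 ->
  exists phi : {rmorphism R -> algC},
    phi f != 0 /\ forall r, ev r = 0 -> phi r = 0.

Lemma poly_nonroot (p : {poly algC}) : p != 0 -> exists b, p.[b] != 0.
Proof.
move=> nz_p; pose rs := [seq (i%:R : algC) | i <- iota 0 (size p)].
have [/allP all_r|/allPn[b _ rb]] := boolP (all (root p) rs); last by exists b.
have : (size rs < size p)%N.
  apply: max_poly_roots => //; first exact/allP.
  by rewrite map_inj_uniq ?iota_uniq // => i j /eqP; rewrite eqr_nat => /eqP.
by rewrite size_map size_iota ltnn.
Qed.

Lemma map_poly_ker (R : comNzRingType) (K1 K2 : fieldType)
    (f1 : {rmorphism R -> K1}) (f2 : {rmorphism R -> K2}) (P : {poly R}) :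
  (forall r, f1 r = 0 -> f2 r = 0) -> map_poly f1 P = 0 -> map_poly f2 P = 0.
Proof.
move=> ker P0; apply/polyP => i; rewrite coef_map coef0; apply: ker.
by rewrite -coef_map P0 coef0.
Qed.

(** Without the top coefficients killed by [f], the leading coefficient survives under [f], as is
    needed for pseudo-division. *)
Lemma map_poly_trim (R : comNzRingType) (K : fieldType)
    (f : {rmorphism R -> K}) (P : {poly R}) :
  map_poly f P != 0 ->
  exists2 m : {poly R}, map_poly f m = map_poly f P & size m = size (map_poly f P).
Proof.
move=> nz; pose k := size (map_poly f P).
have k_gt0 : (0 < k)%N by rewrite lt0n size_poly_eq0.
have Dm : map_poly f (\poly_(i < k) P`_i) = map_poly f P.
  apply/polyP => i; rewrite [LHS]coef_map coef_poly /=.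
  case: ltnP => [_|lei]; first by rewrite coef_map.
  by rewrite raddf0 nth_default.
exists (\poly_(i < k) P`_i) => //; apply: size_poly_eq.
apply: contraNneq nz => h; rewrite -lead_coef_eq0 lead_coefE coef_map.
by rewrite -/k h raddf0.
Qed.

(** One generator [a] is added to the image of [R]. If [a] is transcendental over it, X is sent to
    any number outside a finite set; if algebraic, to a root of the specialization of a relation [m]
    of least degree. *)
Lemma specializable_poly (R : comNzRingType) :
  specializable R -> specializable {poly R}.
Proof.
move=> specR ev f nz_f.
pose ev0 : {rmorphism R -> C} := GRing.RMorphism.clone _ _ (ev \o polyC) _.
pose a := ev 'X; pose M := map_poly ev0.
have evE P : ev P = (M P).[a].
  elim/poly_ind: P => [|P c IHP]; first by rewrite /M !rmorph0 horner0.
  rewrite /M rmorphD rmorphM /= IHP !rmorphD !rmorphM /= map_polyX map_polyC.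
  by rewrite !hornerE.
pose hom (phi0 : {rmorphism R -> algC}) b : {rmorphism {poly R} -> algC} :=
  horner_morph (fun x => mulrC b (phi0 x)).
have homE phi0 b P : hom phi0 b P = (map_poly phi0 P).[b] by [].
have [trans|] := pselect (forall P, ev P = 0 -> M P = 0).
  have nzMf : M f != 0 by apply: contraNneq nz_f => h; rewrite evE h horner0.
  have nz_c : ev0 (f`_(size (M f)).-1) != 0.
    by rewrite -coef_map -lead_coefE lead_coef_eq0.
  have [phi0 [nz_phi ker]] := specR ev0 _ nz_c.
  have [b nz_b] : exists b, (map_poly phi0 f).[b] != 0.
    apply: poly_nonroot; apply: contraNneq nz_phi => h.
    by rewrite -coef_map h coef0.
  exists (hom phi0 b); split=> // P /trans P0.
  by rewrite homE (map_poly_ker ker P0) horner0.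
move=> /existsNP[P0 /not_implyP[evP0 /eqP nzP0]].
(* Algebraic case. The sizes of the relations satisfied by [a] whose leading coefficient survives in
   [C]; the least is taken. *)
pose bad n := `[< exists m, [/\ ev m = 0, M m != 0, size m = size (M m) & size m = n] >].
have bad_ex : exists n, bad n.
  have [m Dm szm] := map_poly_trim nzP0.
  exists (size m); apply/asboolP; exists m; split=> //; last by rewrite szm -Dm.
    by rewrite evE /M Dm -/M -evE.
  by rewrite /M Dm.
case: (ex_minnP bad_ex) => n /asboolP[m [evm nzm szm Dn]] n_min.
have min P : (size (M P) < n)%N -> ev P = 0 -> M P = 0.
  move=> szP evP; apply/eqP; apply: contraTT szP => nzP.
  have [m' Dm' szm'] := map_poly_trim nzP; rewrite -leqNgt -szm'.
  apply: n_min; apply/asboolP; exists m'; split=> //.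
  - by rewrite evE /M Dm' -/M -evE.
  - by rewrite /M Dm'.
  - by rewrite szm' -Dm'.
have good_lead P : M P != 0 -> size P = size (M P) -> ev0 (lead_coef P) != 0.
  by move=> nzP szP; rewrite lead_coefE szP -coef_map -lead_coefE lead_coef_eq0.
have nzc := good_lead m nzm szm; set c := lead_coef m in nzc.
have n_gt1 : (1 < n)%N.
  rewrite ltnNge -Dn; apply/negP => /size1_polyC Dm; move: evm nzc.
  by rewrite /c Dm lead_coefC -[ev _]/(ev0 _) => ->; rewrite eqxx.
have szM P : (size (M P) <= size P)%N by apply: size_poly.
have divm P : exists j q r, c ^+ j *: P = q * m + r /\ (size r < n)%N.
  exists (Pdiv.CommonRing.rscalp P m), (Pdiv.CommonRing.rdivp P m), (Pdiv.CommonRing.rmodp P m); split.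
    exact: Pdiv.ComRing.rdivp_eq.
  by rewrite -Dn Pdiv.CommonRing.ltn_rmodp -size_poly_eq0 Dn -lt0n ltnW.
(* Euclid's algorithm by pseudo-division, [R] being only a ring: [r] and [m] are coprime up to a
   constant [e] that survives in [C]. *)
have bezout k r : (size (M r) <= k)%N -> (size (M r) < n)%N -> M r != 0 ->
    exists q t e, ev0 e != 0 /\ M (r * q + m * t) = (ev0 e)%:P.
  elim: k r => [|k IHk] r; first by rewrite leqn0 size_poly_eq0 => /eqP -> _; rewrite eqxx.
  move=> szk szn nzr; have [r1 Dr1 szr1] := map_poly_trim nzr.
  have nzl : ev0 (lead_coef r1) != 0.
    by apply: good_lead; rewrite /M Dr1 // szr1.
  have MrE q t : M (r * q + m * t) = M (r1 * q + m * t).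
    by rewrite /M !rmorphD !rmorphM /= Dr1.
  have [sz1|sz_gt1] := leqP (size r1) 1.
    exists 1, 0, (lead_coef r1); split=> //.
    rewrite MrE mulr1 mulr0 addr0 /M [in LHS](size1_polyC sz1) map_polyC /=.
    by rewrite lead_coefE; case: (size r1) sz1 => [|[|]].
  pose j := Pdiv.CommonRing.rscalp m r1; pose qq := Pdiv.CommonRing.rdivp m r1; pose r' := Pdiv.CommonRing.rmodp m r1.
  have Dm : lead_coef r1 ^+ j *: m = qq * r1 + r' by apply: Pdiv.ComRing.rdivp_eq.
  have sz_r' : (size r' < size r1)%N.
    by rewrite Pdiv.CommonRing.ltn_rmodp -size_poly_eq0 -lt0n ltnW.
  have sz_Mr' : (size (M r') < size (M r))%N.
    by rewrite -szr1; apply: leq_ltn_trans (szM _) _.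
  have nzlj : ev0 (lead_coef r1) ^+ j != 0 by rewrite expf_neq0.
  (* An exact division would make [a] a root of [r] or of the cofactor [qq], both shorter than
     [m]. *)
  have [r'0|nzr'] := eqVneq (M r') 0.
    have DMm : ev0 (lead_coef r1) ^+ j *: M m = M qq * M r.
      have := congr1 M Dm; rewrite /M map_polyZ rmorphXn rmorphD rmorphM /=.
      by rewrite Dr1 -/M r'0 addr0.
    have ev_r : (M r).[a] != 0.
      by apply: contra nzr => /eqP h; apply/eqP/min => //; rewrite evE.
    have nzqq : M qq != 0.
      apply: contraTneq (nzm) => h; move: DMm; rewrite h mul0r => /eqP.
      by rewrite scaler_eq0 (negPf nzlj) /= => /eqP ->; rewrite eqxx.
    have sz_qq : (size (M qq) < n)%N.
      have := congr1 (fun p : {poly C} => size p) DMm.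
      rewrite size_scale // size_mul // -szm Dn -szr1.
      by move: (size (M qq)) (size r1) sz_gt1 => x y; lia.
    have /negP[] := nzqq; apply/eqP/min => //; rewrite evE.
    have := congr1 (fun p : {poly C} => p.[a]) DMm.
    rewrite hornerZ -evE evm mulr0 hornerM => /esym/eqP.
    by rewrite mulf_eq0 (negPf ev_r) orbF => /eqP.
  have [|||q [t [e [nze He]]]] := IHk r' => //.
  - by rewrite -ltnS (leq_trans sz_Mr').
  - exact: ltn_trans sz_Mr' szn.
  exists (- qq * q), ((lead_coef r1 ^+ j)%:P * q + t), e; split=> //.
  rewrite MrE -He; congr (M _).
  have -> : r' = (lead_coef r1 ^+ j)%:P * m - qq * r1.
    by rewrite mul_polyC Dm; ring.
  by ring.
have [q [t [e [nze He]]]] : exists q t e, ev0 e != 0 /\ M (f * q + m * t) = (ev0 e)%:P.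
  have [j [qq [r [Dr szr]]]] := divm f.
  have [||q [t [e [nze He]]]] := bezout _ r (leqnn _).
  - exact: leq_ltn_trans (szM _) _.
  - apply: contraNneq nz_f => r0; have := congr1 ev Dr.
    rewrite -mul_polyC rmorphD !rmorphM /= evm mulr0 add0r [ev r]evE r0 horner0.
    rewrite -[ev _]/(ev0 _) rmorphXn => /eqP.
    by rewrite mulf_eq0 expf_eq0 (negPf nzc) andbF => /eqP ->.
  exists ((c ^+ j)%:P * q), (t - qq * q), e; split=> //.
  rewrite -He; congr (M _).
  have -> : r = (c ^+ j)%:P * f - qq * m by rewrite mul_polyC Dr; ring.
  by ring.
(* Keeping [c] nonzero preserves the degree of [m], so that a root [b] exists; keeping [e] nonzero
   prevents [f] from vanishing at [b]. *)
have nzce : ev0 (c * e) != 0 by rewrite rmorphM mulf_neq0.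
have [phi0 [nzphi ker]] := specR ev0 _ nzce.
move: nzphi; rewrite rmorphM mulf_eq0 negb_or => /andP[nzphic nzphie].
have szphi : size (map_poly phi0 m) = n.
  rewrite -Dn; apply/eqP; rewrite eqn_leq size_poly /=.
  rewrite {1}Dn -(ltn_predK n_gt1); apply: contraR nzphic; rewrite -leqNgt => h.
  by rewrite /c lead_coefE Dn -coef_map nth_default.
have [|b rb] := closed_rootP (map_poly phi0 m) _; first by rewrite szphi gtn_eqF.
have homm : hom phi0 b m = 0 by rewrite homE; apply/eqP.
exists (hom phi0 b); split=> [|P evP].
  apply: contraNneq nzphie => homf.
  have : map_poly phi0 (f * q + m * t - e%:P) = 0.
    by apply: map_poly_ker ker _; rewrite rmorphB /= map_polyC -/M He subrr.
  rewrite rmorphB /= map_polyC /= => /(congr1 (fun p : {poly algC} => p.[b])).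
  rewrite hornerD hornerN hornerC horner0 -homE rmorphD !rmorphM /= homf homm.
  by rewrite !mul0r !add0r => /eqP; rewrite oppr_eq0.
(* Up to a power of [c], [P] is a multiple of [m] plus a remainder that vanishes at [a] and is too
   short to be a relation. *)
have [j [qq [r [Dr szr]]]] := divm P.
have r0 : M r = 0.
  apply: min; first exact: leq_ltn_trans (szM _) _.
  have := congr1 ev Dr; rewrite -mul_polyC rmorphD !rmorphM /= evm evP !mulr0.
  by rewrite add0r.
have := congr1 (hom phi0 b) Dr; rewrite -mul_polyC rmorphD !rmorphM homm mulr0.
rewrite add0r [hom phi0 b r]homE (map_poly_ker ker r0) horner0 homE map_polyC hornerC.
by move=> /eqP; rewrite mulf_eq0 /= rmorphXn expf_eq0 (negPf nzphic) andbF => /eqP.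
Qed.

End Specialization.

(** [R] is a polynomial ring over the rationals with one variable for each entry of [A]. *)
Lemma specializable_cover (C : numFieldType) (A : seq C) :
  exists (R : comNzRingType) (ev : {rmorphism R -> C}),
    specializable C R /\ {in A, forall a, exists r, ev r = a}.
Proof.
elim: A => [|a A [R [ev [specR evA]]]].
  exists rat, (ratr : {rmorphism rat -> C}); split=> // ev f nz_f.
  exists (ratr : {rmorphism rat -> algC}).
  have nzf : f != 0 by apply: contraNneq nz_f => ->; rewrite rmorph0.
  split=> [|r evr]; first by rewrite fmorph_eq0.
  by apply/eqP; rewrite fmorph_eq0 -(fmorph_eq0 ev) evr.
exists {poly R}, (horner_morph (fun x => mulrC a (ev x))); split.
  exact: specializable_poly.
move=> b; rewrite inE => /predU1P[->|/evA[r <-]].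
  by exists 'X; apply: horner_morphX.
by exists r%:P; apply: horner_morphC.
Qed.

(** * Packing *)

Lemma geometric_sum (q n : nat) :
  (q * \sum_(j < n) q.+1 ^ j + 1 = q.+1 ^ n)%N.
Proof.
elim: n => [|n IHn]; first by rewrite big_ord0 muln0.
by rewrite big_ord_recr /= mulnDr addnAC IHn expnS mulSn.
Qed.

Section Packing.

Variables (U : comUnitRingType) (F : numFieldType) (N : U -> F).
Hypothesis N1 : N 1 <= 1.
Hypothesis N_ge1 : forall v, 1 <= N v.
Hypothesis NM : forall v w, N (v * w) <= N v * N w.
Hypothesis NV : forall v, v \is a GRing.unit -> N v^-1 <= N v.
Hypothesis Nsqr : forall v, N v ^+ 2 <= N (v ^+ 2).

Lemma subnorm_gt0 v : 0 < N v. Proof. exact: lt_le_trans ltr01 (N_ge1 v). Qed.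
Lemma subnorm_ge0 v : 0 <= N v. Proof. exact/ltW/subnorm_gt0. Qed.

Lemma subnorm_pow2 q v : N (v ^+ (2 ^ q)) = N v ^+ (2 ^ q).
Proof.
elim: q => [|q IHq]; first by rewrite !expr1.
rewrite expnSr !exprM -IHq; apply/eqP; rewrite eq_le Nsqr andbT.
by rewrite !expr2 NM.
Qed.

Lemma subnorm_prod m (v : nat -> U) : N (\prod_(i < m) v i) <= \prod_(i < m) N (v i).
Proof.
elim: m => [|m IHm]; first by rewrite !big_ord0.
rewrite !big_ord_recr /=; apply: le_trans (NM _ _) _.
by rewrite ler_wpM2r ?subnorm_ge0.
Qed.

Lemma subnorm_div_lower v w : w \is a GRing.unit -> N v <= N (v / w) * N w.
Proof. by move=> uw; rewrite -{1}(divrK uw v) NM. Qed.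

(** Uniqueness of digits in mixed radix. The quotient of two distinct top digits would equal a
    product of quotients of lower digits, of norm at most the product of the [r j]; equal top digits
    cancel. *)
Lemma digits_inj m k (w : nat -> nat -> U) (r : nat -> F) (f g : nat -> nat) :
  (forall i a, w i a \is a GRing.unit) ->
  (forall i a b, (i < m)%N -> (a < k)%N -> (b < k)%N -> N (w i a / w i b) <= r i) ->
  (forall i a b, (i < m)%N -> (a < k)%N -> (b < k)%N -> a != b ->
     \prod_(j < i) r j < N (w i a / w i b)) ->
  (forall i, (i < m)%N -> (f i < k)%N /\ (g i < k)%N) ->
  \prod_(i < m) w i (f i) = \prod_(i < m) w i (g i) ->
  forall i, (i < m)%N -> f i = g i.
Proof.
move=> wU; elim: m => [//|m IHm] wr wsep fg; rewrite !big_ord_recr /= => eqp.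
have [fm gm] := fg m (ltnSn m).
have fgm : f m = g m.
  apply/eqP; apply/negPn/negP => ne.
  have := wsep m _ _ (ltnSn m) fm gm ne; apply/negP.
  have r_ge0 : 0 <= \prod_(j < m) r j.
    apply: prodr_ge0 => j _; apply: le_trans (subnorm_ge0 (w j (f m) / w j (g m))) _.
    by apply: wr; rewrite // ltnS ltnW.
  rewrite -real_leNgt ?ger0_real ?subnorm_ge0 //.
  have -> : w m (f m) / w m (g m) = \prod_(i < m) (w i (g i) / w i (f i)).
    rewrite big_split /= prodrV; last by move=> i _; apply: wU.
    have uP : \prod_(i < m) w i (f i) \is a GRing.unit.
      by apply: rpred_prod => i _; apply: wU.
    apply: (mulrI uP); rewrite mulrA eqp mulrK ?wU //.
    by rewrite mulrCA mulrV // mulr1.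
  apply: le_trans (subnorm_prod m (fun i => w i (g i) / w i (f i))) _; apply: ler_prod => i _; rewrite subnorm_ge0 /=.
  have lti : (i < m.+1)%N by rewrite ltnS ltnW.
  by have [fi gi] := fg i lti; apply: wr.
move=> i; rewrite ltnS leq_eqVlt => /predU1P[-> //|lti].
apply: IHm => //.
- by move=> *; apply: wr => //; apply: ltnW.
- by move=> *; apply: wsep => //; apply: ltnW.
- by move=> *; apply: fg; apply: ltnW.
- by move: eqp; rewrite fgm => /(mulIr (wU m (g m))).
Qed.

Lemma digits_card m k (w : nat -> nat -> U) (r : nat -> F) (T : {fset U}) :
  (forall i a, w i a \is a GRing.unit) ->
  (forall i a b, (i < m)%N -> (a < k)%N -> (b < k)%N -> N (w i a / w i b) <= r i) ->
  (forall i a b, (i < m)%N -> (a < k)%N -> (b < k)%N -> a != b ->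
     \prod_(j < i) r j < N (w i a / w i b)) ->
  (forall f : nat -> nat, (forall i, (i < m)%N -> (f i < k)%N) ->
     \prod_(i < m) w i (f i) \in T) ->
  (k ^ m <= #|` T|)%N.
Proof.
move=> wU wr wsep wT; pose fn (f : {ffun 'I_m -> 'I_k}) i : nat :=
  if insub i is Some j then f j else 0%N.
have fnE f (i : 'I_m) : fn f i = f i by rewrite /fn valK.
have fnk f i : (i < m)%N -> (fn f i < k)%N.
  by move=> lti; rewrite -[ i ]/(val (Ordinal lti)) fnE.
have fT f := wT (fn f) (fnk f).
pose F1 f : T := [` fT f].
have F1inj : injective F1.
  move=> f g /(congr1 val) /= eqfg; apply/ffunP => i; apply: val_inj => /=.
  rewrite -!fnE; apply: (digits_inj wU wr wsep _ eqfg) => // j ltj.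
  by split; apply: fnk.
by have := leq_card F1 F1inj; rewrite card_ffun !card_ord -cardfE.
Qed.

(* The products of the v (f i) ^ (Q ^ i) are distinct by comparing leading
   digits, as for expansions in base Q. *)
Lemma packing m k q c B (v : nat -> U) (T : {fset U}) :
  1 < B -> (0 < c)%N -> (2 * c < 2 ^ q)%N ->
  (forall a, v a \is a GRing.unit) ->
  (forall a, (a < k)%N -> N (v a) <= B) ->
  (forall a b, (a < k)%N -> (b < k)%N -> a != b -> B <= N (v a / v b) ^+ c) ->
  (forall f : nat -> nat, (forall i, (i < m)%N -> (f i < k)%N) ->
     \prod_(i < m) v (f i) ^+ ((2 ^ q) ^ i) \in T) ->
  (k ^ m <= #|` T|)%N.
Proof.
move=> B1 c0 qc vU vB vsep vT; pose Q := (2 ^ q)%N.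
have B0 : 0 < B := lt_trans ltr01 B1.
have NX i z : N (z ^+ (Q ^ i)) = N z ^+ (Q ^ i) by rewrite /Q -expnM subnorm_pow2.
have wE i a b : v a ^+ (Q ^ i) / v b ^+ (Q ^ i) = (v a / v b) ^+ (Q ^ i).
  by rewrite exprMn exprVn.
apply: (@digits_card m k (fun i a => v a ^+ (Q ^ i)) (fun i => (B ^+ 2) ^+ (Q ^ i))) => //.
- by move=> i a; rewrite unitrX.
- move=> i a b _ ak bk; rewrite wE NX lerXn2r ?nnegrE ?subnorm_ge0 ?exprn_ge0 ?(ltW B0) //.
  apply: le_trans (NM _ _) _; rewrite expr2 ler_pM ?subnorm_ge0 ?vB //.
  exact: le_trans (NV (vU b)) (vB b bk).
move=> i a b _ ak bk ab; rewrite wE NX.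
(* After raising to the power [c], exponents of [B] are compared: 2 c S < Q^i, where S is the sum of
   the Q^j with j < i. This follows from 2 c < Q and [geometric_sum]. *)
rewrite -(@ltr_pXn2r _ c) ?nnegrE ?exprn_ge0 ?subnorm_ge0 //; last first.
  by apply: prodr_ge0 => j _; rewrite !exprn_ge0 // ltW.
apply: (@lt_le_trans _ _ (B ^+ (Q ^ i))); last first.
  rewrite -exprM mulnC exprM lerXn2r ?nnegrE ?exprn_ge0 ?subnorm_ge0 ?(ltW B0) //.
  exact: vsep.
have -> : \prod_(j < i) B ^+ 2 ^+ (Q ^ j) = B ^+ (2 * \sum_(j < i) Q ^ j).
  by elim: i => [|i IHi]; rewrite ?big_ord0 ?big_ord_recr ?muln0 //= IHi mulnDr exprD -exprM.
rewrite -exprM ltr_eXn2l //.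
have Q0 : (0 < Q)%N by rewrite expn_gt0.
have := geometric_sum Q.-1 i; rewrite prednK //.
by move: (\sum_(j < i) _)%N (Q ^ i)%N => S P; rewrite -/Q in qc; nia.
Qed.

(** Digit [i] runs over the i-th block of [k] consecutive terms. Growth by fifth powers keeps the
    radii of all earlier blocks below the fourth power of any later term, with one power left for
    the quotient. *)
Lemma lacunary m k (v : nat -> U) (T : {fset U}) :
  (forall a, v a \is a GRing.unit) ->
  (forall a b, (a < b)%N -> (b < m * k)%N -> N (v a) ^+ 5 < N (v b)) ->
  (forall f : nat -> nat, (forall i, (i < m)%N -> (f i < k)%N) ->
     \prod_(i < m) v (i * k + f i)%N \in T) ->
  (k ^ m <= #|` T|)%N.
Proof.
move=> vU vlac vT.
(* For k = 0 and m = 0 the empty product shows that [T] is nonempty. *)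
case: k vlac vT => [|k] vlac vT.
  case: m vlac vT => [|m] _ vT; last by rewrite exp0n.
  rewrite expn0 cardfs_gt0; apply/fset0Pn; exists 1.
  by have := vT id; rewrite big_ord0; apply.
have vmono a b : (a <= b)%N -> (b < m * k.+1)%N -> N (v a) <= N (v b).
  rewrite leq_eqVlt => /predU1P[-> //|ab bm]; apply: le_trans (ltW (vlac a b ab bm)).
  by rewrite ler_eXnr.
pose r i := N (v (i * k.+1 + k)%N) ^+ 2.
have idx i a : (i < m)%N -> (a < k.+1)%N -> (i * k.+1 + a < m * k.+1)%N by nia.
apply: (@digits_card m k.+1 (fun i a => v (i * k.+1 + a)%N) r) => //.
  move=> i a b im ak bk; apply: le_trans (NM _ _) _; rewrite /r expr2.
  rewrite ler_pM ?subnorm_ge0 //; first by apply: vmono; [lia | apply: idx].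
  by apply: le_trans (NV (vU _)) _; apply: vmono; [lia | apply: idx].
have rprod i a : (i * k.+1 <= a)%N -> (a < m * k.+1)%N ->
    \prod_(j < i) r j <= N (v a) ^+ 4.
  elim: i a => [|i IHi] a ia am; first by rewrite big_ord0 exprn_ege1.
  rewrite big_ord_recr /=; have im : (i < m)%N by nia.
  have il := idx i k im (ltnSn k).
  apply: (@le_trans _ _ (N (v (i * k.+1 + k)%N) ^+ 4 * N (v (i * k.+1 + k)%N) ^+ 2)).
    rewrite ler_wpM2r ?exprn_ge0 ?subnorm_ge0 //; apply: IHi => //; lia.
  have h : N (v (i * k.+1 + k)%N) ^+ 5 <= N (v a) by apply/ltW/vlac => //; lia.
  rewrite -exprD; apply: (@le_trans _ _ ((N (v (i * k.+1 + k)%N) ^+ 5) ^+ 4)).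
    by rewrite -exprM ler_weXn2l.
  by rewrite lerXn2r ?nnegrE ?exprn_ge0 ?subnorm_ge0.
have sep i a b : (i < m)%N -> (a < k.+1)%N -> (b < k.+1)%N -> (a < b)%N ->
    \prod_(j < i) r j < N (v (i * k.+1 + b)%N / v (i * k.+1 + a)%N).
  move=> im ak bk ab; have ia := idx i a im ak; have ib := idx i b im bk.
  apply: le_lt_trans (rprod i (i * k.+1 + a)%N _ ia) _; first by lia.
  rewrite -(ltr_pM2r (subnorm_gt0 (v (i * k.+1 + a)%N))) -exprSr.
  apply: lt_le_trans (subnorm_div_lower _ (vU _)); apply: vlac => //; lia.
move=> i a b im ak bk; rewrite neq_ltn => /orP[ab|ba]; last exact: sep.
apply: lt_le_trans (sep i a b im ak bk ab) _.
rewrite -[X in N X <= _]invrK; apply: le_trans (NV _) _; last first.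
  by rewrite invrM ?unitrV ?vU // invrK mulrC.
by rewrite unitrV unitrM unitrV !vU.
Qed.

End Packing.

(** * Plünnecke's inequality *)

Section MulSets.

Variable L : fieldType.
Implicit Types X Y Z C : {fset L}.

Definition mulset X Y : {fset L} := [fset (x * y)%R | x in X, y in Y].

Fixpoint powset Y n : {fset L} :=
  if n is k.+1 then mulset Y (powset Y k) else [fset 1%R].

Lemma mulsetP X Y z :
  reflect (exists x y, [/\ x \in X, y \in Y & z = x * y]) (z \in mulset X Y).
Proof.
apply: (iffP (imfset2P _ _ _ _ _)) => [[x /= xX [y /= yY ->]]|[x [y [xX yY ->]]]].
  by exists x, y.
by exists x => //; exists y.
Qed.

Lemma mem_mulset X Y x y : x \in X -> y \in Y -> x * y \in mulset X Y.
Proof. by move=> xX yY; apply/mulsetP; exists x, y. Qed.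

Lemma mulsetA X Y Z : mulset X (mulset Y Z) = mulset (mulset X Y) Z.
Proof.
apply/fsetP => z; apply/mulsetP/mulsetP => [[x [_ [xX /mulsetP[y [w [yY wZ ->]]] ->]]]|].
  by exists (x * y), w; split; rewrite ?mulrA ?mem_mulset.
case=> [_ [w [/mulsetP[x [y [xX yY ->]]] wZ ->]]].
by exists x, (y * w); split; rewrite ?mulrA ?mem_mulset.
Qed.

Lemma mulset1 X : mulset X [fset 1] = X.
Proof.
apply/fsetP => z; apply/mulsetP/idP => [[x [y [xX]]]|zX].
  by rewrite inE => /eqP -> ->; rewrite mulr1.
by exists z, 1; rewrite inE mulr1.
Qed.

Lemma mulset0 X : mulset X fset0 = fset0.
Proof. by apply/fsetP => z; rewrite inE; apply/mulsetP => -[x [y []]]. Qed.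

Lemma mulset_neq0 X Y : 0 \notin X -> 0 \notin Y -> 0 \notin mulset X Y.
Proof.
move=> X0 Y0; apply/mulsetP => -[x [y [xX yY /esym/eqP]]].
by rewrite mulf_eq0 => /orP[] /eqP h; move: xX yY; rewrite h ?(negPf X0) ?(negPf Y0).
Qed.

Lemma powset_neq0 Y n : 0 \notin Y -> 0 \notin powset Y n.
Proof.
move=> Y0; elim: n => [|n IHn]; first by rewrite inE eq_sym oner_eq0.
exact: mulset_neq0.
Qed.

Lemma card_scale c X : c != 0 -> #|` [fset (c * x)%R | x in X]| = #|` X|.
Proof. by move=> nz_c; apply: card_imfset; apply: mulfI. Qed.

Lemma card_mulset_ge X Y x : x \in X -> x != 0 -> (#|` Y| <= #|` mulset X Y|)%N.
Proof.
move=> xX nz_x; rewrite -(card_scale Y nz_x); apply: fsubset_leq_card.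
by apply/fsubsetP => _ /imfsetP[y /= yY ->]; apply: mem_mulset.
Qed.

Lemma card_powset_mono Y m n : 0 \notin Y -> (0 < #|` Y|)%N -> (m <= n)%N ->
  (#|` powset Y m| <= #|` powset Y n|)%N.
Proof.
rewrite cardfs_gt0 => Y0 /fset0Pn[y yY] /subnKC <-.
elim: (n - m)%N => [|k IHk]; first by rewrite addn0.
rewrite addnS; apply: leq_trans IHk _; apply: (card_mulset_ge _ yY).
by apply: contraNneq Y0 => <-.
Qed.

Lemma prod_powset Y m (x : nat -> L) (e : nat -> nat) :
  (forall i, (i < m)%N -> x i \in Y) ->
  \prod_(i < m) x i ^+ e i \in powset Y (\sum_(i < m) e i).
Proof.
elim: m => [|m IHm] xY; first by rewrite !big_ord0 inE.
have {}IHm : \prod_(i < m) x i ^+ e i \in powset Y (\sum_(i < m) e i).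
  by apply: IHm => i /ltnW; apply: xY.
rewrite !big_ord_recr /= mulrC addnC; elim: (e m) => [|k IHk].
  by rewrite expr0 mul1r.
by rewrite exprS -mulrA addSn; apply: mem_mulset; rewrite ?xY.
Qed.

(** [X] minimizes |ZY| / |Z| among its subsets. By induction on [C]: when [c] is added, the new
    elements on both sides are counted through the set [Z] of those x with x c already in [XC']. *)
Lemma petridis X Y C :
  (forall Z, Z `<=` X -> #|` mulset X Y| * #|` Z| <= #|` mulset Z Y| * #|` X|)%N ->
  0 \notin C ->
  (#|` mulset (mulset X Y) C| * #|` X| <= #|` mulset X Y| * #|` mulset X C|)%N.
Proof.
move=> minX; elim/finSet_rect: C => C IHC C0.
have [->|/fset0Pn[c cC]] := eqVneq C fset0.
  by rewrite mulset0 cardfs0.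
have nz_c : c != 0 by apply: contraNneq C0 => <-.
pose C' := C `\ c; pose XC' := mulset X C'.
have C'C : C' `<=` C by apply: fsubD1set.
have {}IHC : (#|` mulset (mulset X Y) C'| * #|` X| <= #|` mulset X Y| * #|` XC'|)%N.
  apply: IHC; first by apply: fproperD1.
  by apply: contra C0; apply/fsubsetP.
pose Z := [fset x in X | x * c \in XC'].
have ZX : Z `<=` X by apply/fsubsetP => x; rewrite !inE => /andP[].
have {}minX := minX Z ZX.
have ZY : mulset Z Y `<=` mulset X Y.
  apply/fsubsetP => _ /mulsetP[x [y [xZ yY ->]]].
  by apply: mem_mulset => //; apply: (fsubsetP ZX).
(* Every new element is [c] times an element of XY outside ZY. *)
have up : (#|` mulset (mulset X Y) C| <=
           #|` mulset (mulset X Y) C'| + (#|` mulset X Y| - #|` mulset Z Y|))%N.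
  rewrite -cardfsDS // -(card_scale (mulset X Y `\` mulset Z Y) nz_c).
  apply: leq_trans (leq_card_fsetU _ _); apply: fsubset_leq_card.
  apply/fsubsetP => _ /mulsetP[w [c' [wXY c'C ->]]]; rewrite in_fsetU.
  have [c'c|ne] := eqVneq c' c; last first.
    by apply/orP; left; apply: mem_mulset => //; rewrite !inE ne.
  rewrite {}c'c {c' c'C}; have [wZ|wZ] := boolP (w \in mulset Z Y); last first.
    apply/orP; right; apply/imfsetP; exists w => /=; last by rewrite mulrC.
    by rewrite in_fsetD wZ.
  apply/orP; left; move/mulsetP: wZ => [z [y [zZ yY ->]]].
  move: zZ; rewrite !inE => /andP[zX /mulsetP[x' [c' [x'X c'C' E]]]].
  by rewrite mulrAC E mulrAC; apply: mem_mulset => //; apply: mem_mulset.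
(* The elements x c with x outside [Z] are new and distinct. *)
have low : (#|` XC'| + (#|` X| - #|` Z|) <= #|` mulset X C|)%N.
  rewrite -cardfsDS // -(card_scale (X `\` Z) nz_c) -cardfsUI.
  have -> : XC' `&` [fset (c * x)%R | x in X `\` Z] = fset0.
    apply/fsetP => w; rewrite in_fsetI in_fset0; apply/negP => /andP[wXC'].
    case/imfsetP => x /=; rewrite in_fsetD => /andP[xZ xX] Dw.
    by case/negP: xZ; rewrite !inE xX mulrC -Dw.
  rewrite cardfs0 addn0; apply: fsubset_leq_card; rewrite fsubUset; apply/andP; split.
    apply/fsubsetP => _ /mulsetP[x [c' [xX c'C ->]]].
    by apply: mem_mulset => //; apply: (fsubsetP C'C).
  apply/fsubsetP => _ /imfsetP[x /= xX ->]; rewrite mulrC; apply: mem_mulset => //.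
  by move: xX; rewrite in_fsetD => /andP[].
have zx := fsubset_leq_card ZX; have zy := fsubset_leq_card ZY.
move: (#|` mulset (mulset X Y) C|) (#|` mulset (mulset X Y) C'|) (#|` mulset X Y|)
  (#|` mulset Z Y|) (#|` mulset X C|) (#|` XC'|) (#|` X|) (#|` Z|)
  IHC minX up low zx zy => a a' p pz b b' x z h1 h2 h3 h4 h5 h6.
have: (a * x <= a' * x + (p - pz) * x)%N by rewrite -mulnDl leq_mul2r h3 orbT.
have: (p * b' + p * (x - z) <= p * b)%N by rewrite -mulnDr leq_mul2l h4 orbT.
rewrite mulnBl mulnBr => e1 e2.
apply: leq_trans e2 _; apply: leq_trans e1; lia.
Qed.

Lemma petridis_minimizer X Y : (0 < #|` X|)%N -> exists X', [/\ X' `<=` X,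
  (0 < #|` X'|)%N, (#|` mulset X' Y| * #|` X| <= #|` mulset X Y| * #|` X'|)%N &
  forall Z, Z `<=` X' ->
    (#|` mulset X' Y| * #|` Z| <= #|` mulset Z Y| * #|` X'|)%N].
Proof.
elim/finSet_rect: X => X IHX X_gt0.
have [minX|] := pselect (forall Z, Z `<=` X ->
    (#|` mulset X Y| * #|` Z| <= #|` mulset Z Y| * #|` X|)%N).
  by exists X; split.
move=> /existsNP[Z /not_implyP[ZX /negP]]; rewrite -ltnNge => lt.
have Z_gt0 : (0 < #|` Z|)%N by move: lt; case: #|` Z| => //; rewrite muln0.
have ZpX : Z `<` X.
  by rewrite fproperEneq ZX andbT; apply: contraTneq lt => ->; rewrite ltnn.
have [X' [X'Z X'_gt0 le1 minX']] := IHX Z ZpX Z_gt0.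
exists X'; split=> //; first exact: fsubset_trans X'Z ZX.
rewrite -(leq_pmul2r Z_gt0).
apply: (@leq_trans (#|` mulset Z Y| * #|` X'| * #|` X|)%N).
  by rewrite mulnAC leq_mul2r le1 orbT.
by rewrite mulnAC [X in (_ <= X)%N]mulnAC leq_mul2r (ltnW lt) orbT.
Qed.

(** [petridis] is iterated for a minimizing subset [X'] with C = Y^k; then |Y^n| <= |X' Y^n|, and
    the ratio of [X'] is at most that of [X]. *)
Lemma plunnecke X Y n : 0 \notin X -> 0 \notin Y -> (0 < #|` X|)%N ->
  (#|` powset Y n| * #|` X| ^ n <= #|` mulset X Y| ^ n * #|` X|)%N.
Proof.
move=> X0 Y0 X_gt0; have [X' [X'X X'_gt0 le1 minX']] := petridis_minimizer Y X_gt0.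
have iter k : (#|` mulset X' (powset Y k)| * #|` X'| ^ k <=
               #|` mulset X' Y| ^ k * #|` X'|)%N.
  elim: k => [|k IHk]; first by rewrite /= mulset1 !expn0 muln1 mul1n.
  rewrite /= mulsetA; have := petridis minX' (powset_neq0 k Y0) => h.
  rewrite expnS mulnA; apply: (leq_trans (leq_mul h (leqnn _))).
  by rewrite -mulnA expnS -mulnA leq_mul2l IHk orbT.
have [x xX'] : exists x, x \in X' by apply/fset0Pn; rewrite -cardfs_gt0.
have nz_x : x != 0 by apply: contraNneq X0 => <-; apply: (fsubsetP X'X).
have X'n_gt0 : (0 < #|` X'| ^ n)%N by rewrite expn_gt0 X'_gt0.
rewrite -(leq_pmul2r X'n_gt0).
apply: (@leq_trans (#|` mulset X' Y| ^ n * #|` X'| * #|` X| ^ n)%N).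
  rewrite mulnAC leq_mul2r; apply/orP; right; apply: leq_trans (iter n).
  by rewrite leq_mul2r; apply/orP; right; apply: card_mulset_ge xX' nz_x.
rewrite mulnAC -expnMn [X in (_ <= X)%N]mulnAC -expnMn; apply: leq_mul.
  by case: (n) => // k; rewrite leq_exp2r.
exact: fsubset_leq_card.
Qed.

End MulSets.

(** * Counting solutions of x - y = 1 *)

(** The exponent 16 is the number of digits used in [solution_count]. *)
Lemma maximal_root (M : nat) : exists Z,
  (Z ^ 16 <= M)%N /\ forall z, (z ^ 16 <= M)%N -> (z <= Z)%N.
Proof.
have ex0 : exists z, (z ^ 16 <= M)%N by exists 0%N; rewrite exp0n.
have bnd z : (z ^ 16 <= M)%N -> (z <= M)%N.
  apply: leq_trans; case: z => // z; by rewrite -{1}(expn1 z.+1) leq_pexp2l.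
by have [Z ZM Zmax] := ex_maxnP ex0 bnd; exists Z.
Qed.

(** Keep the first element, drop the at most [k] elements near it, and repeat. As [near] may fail to
    be symmetric, separation follows the order of [D]. *)
Lemma greedy_separated (T : eqType) (near : rel T) (k : nat) (s : seq T) :
  uniq s -> (forall x, x \in s -> (size [seq y <- s | near x y] <= k)%N) ->
  (forall x, x \in s -> near x x) ->
  exists D, [/\ uniq D, {subset D <= s}, (size s <= k * size D)%N &
    pairwise (fun x y => ~~ near x y) D].
Proof.
move: {2}(size s) (leqnn (size s)) => n; elim: n s => [|n IHn] s.
  rewrite leqn0 size_eq0 => /eqP -> _ _ _; exists [::]; split=> //.
case: s => [|x s] szn us nk nr; first by exists [::]; split.
pose s' := [seq y <- x :: s | ~~ near x y].
have ss' : {subset s' <= x :: s} by move=> y; rewrite mem_filter => /andP[].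
have nxx : near x x by apply: nr; rewrite mem_head.
have [||y ys|y ys|D [uD Ds szD pD]] := IHn s'.
- rewrite -ltnS; apply: leq_trans szn; rewrite /s' /= nxx /= ltnS size_filter.
  exact: count_size.
- exact: filter_uniq.
- apply: leq_trans (nk y (ss' y ys)); rewrite /s' -filter_predI.
  by rewrite size_filter [X in (_ <= X)%N]size_filter; apply: sub_count => z /= /andP[].
- exact/nr/ss'.
exists (x :: D); split.
- rewrite /= uD andbT; apply: contraL nxx => /Ds; by rewrite mem_filter => /andP[].
- move=> y; rewrite inE => /predU1P[->|/Ds/ss' //]; exact: mem_head.
- rewrite -[size (x :: D)]/(size D).+1 mulnS -(count_predC (near x) (x :: s)) leq_add //.
    by rewrite -size_filter; apply: nk; apply: mem_head.
  by rewrite -size_filter.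
- rewrite /= pD andbT; apply/allP => y /Ds; by rewrite mem_filter => /andP[].
Qed.

(** The same greedy choice, always keeping an element with the least value of [h] and dropping all
    values up to its fifth power. *)
Lemma lacunary_subsequence (T : eqType) (F : numDomainType) (h : T -> F)
    (k : nat) (s : seq T) :
  uniq s -> (forall x, 1 <= h x) ->
  (forall x, x \in s ->
     (size [seq y <- s | ((h x <= h y) && (h y <= h x ^+ 5))%R] <= k)%N) ->
  exists D, [/\ {subset D <= s}, (size s <= k * size D)%N &
    pairwise (fun x y => h x ^+ 5 < h y) D].
Proof.
move=> + h1; move: {2}(size s) (leqnn (size s)) => n; elim: n s => [|n IHn] s.
  rewrite leqn0 size_eq0 => /eqP -> _ _; by exists [::]; split.
move=> szn us sk; have [->|] := eqVneq s [::]; first by exists [::]; split.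
rewrite -size_eq0 -lt0n => sz_gt0.
have hR x : h x \is Num.real by apply: ger0_real; apply: le_trans (h1 x).
have [x xs xmin] : exists2 x, x \in s & {in s, forall y, h x <= h y}.
  elim: s sz_gt0 {szn us sk} => // y [|z s] IHs _.
    by exists y; rewrite ?mem_head // => z; rewrite inE => /eqP ->.
  have [//|x xs xmin] := IHs.
  have [yx|xy] := real_leP (hR y) (hR x).
    exists y; rewrite ?mem_head // => w; rewrite inE => /predU1P[-> //|/xmin].
    exact: le_trans.
  exists x; first by rewrite inE xs orbT.
  by move=> w; rewrite inE => /predU1P[->|/xmin //]; apply: ltW.
pose s' := [seq y <- s | h x ^+ 5 < h y].
have ss' : {subset s' <= s} by move=> y; rewrite mem_filter => /andP[].
have [|||D [Ds szD pD]] := IHn s'.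
- rewrite -ltnS; apply: leq_trans szn; rewrite /s' size_filter.
  rewrite -(count_predC (fun y => h x ^+ 5 < h y) s) -[X in (X < _)%N]addn0 ltn_add2l.
  rewrite -has_count; apply/hasP; exists x => //=.
  by rewrite -real_leNgt ?rpredX // ler_eXnr.
- exact: filter_uniq.
- move=> y ys; apply: leq_trans (sk y (ss' y ys)); rewrite /s' -filter_predI.
  by rewrite size_filter [X in (_ <= X)%N]size_filter; apply: sub_count => z /= /andP[].
exists (x :: D); split.
- by move=> y; rewrite inE => /predU1P[->|/Ds/ss' //].
- rewrite /= mulnS -(count_predC (fun y => h y <= h x ^+ 5) s) leq_add //.
    apply: leq_trans (sk x xs); rewrite -size_filter.
    rewrite (@eq_in_filter _ _ (fun y => (h x <= h y) && (h y <= h x ^+ 5))) //.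
    by move=> y ys /=; rewrite xmin.
  apply: leq_trans szD; rewrite /s' size_filter; apply: sub_count => y /=.
  by rewrite real_ltNge ?rpredX.
- rewrite /= pD andbT; apply/allP => y /Ds; by rewrite mem_filter => /andP[].
Qed.

Lemma bernoulli_ineq (e : algC) k : 0 <= e -> 1 + k%:R * e <= (1 + e) ^+ k.
Proof.
move=> e0; elim: k => [|k IHk]; first by rewrite mul0r addr0 expr0.
rewrite exprSr; apply: le_trans (ler_wpM2r _ IHk); last by rewrite addr_ge0.
have -> : (1 + k%:R * e) * (1 + e) = 1 + k.+1%:R * e + k%:R * e * e.
  by rewrite -[k.+1%:R]natr1; ring.
by rewrite lerDl !mulr_ge0.
Qed.

(** 256 is the square of the constant of [height_gap], and 13/12 is the 14th power of the separation
    per conjugate; k >= 3 ensures 14 k >= 30. *)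
Lemma bernoulli_13_12 : exists k, (3 <= k)%N /\ 256 <= (13%:R / 12%:R : algC) ^+ k.
Proof.
pose e : algC := 12%:R^-1; have e0 : 0 <= e by rewrite invr_ge0.
have De : 13%:R / 12%:R = 1 + e.
  have -> : 13%:R = 12%:R + 1 :> algC by rewrite natr1.
  by rewrite mulrDl divff ?mul1r ?pnatr_eq0.
exists (255 * 12)%N; split=> //; rewrite De; apply: le_trans (bernoulli_ineq _ e0).
by rewrite natrM mulfK ?pnatr_eq0 // addrC natr1.
Qed.

(** * The height on pairs *)

Section PairNorm.

Variables (L : fieldType) (G : finType) (s : G -> {rmorphism L -> algC}).
Hypothesis conjpoly_rat : forall x, conjpoly s x \is a polyOver Crat.
Local Notation height := (height conjpoly_rat).

Definition pair_height (v : L * L) : algC := height v.1 * height v.2.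

Lemma pair_height1 : pair_height 1 <= 1.
Proof.
by rewrite /pair_height -[leRHS]mulr1; apply: ler_pM;
  [exact/ltW/height_gt0|exact/ltW/height_gt0|exact: height1|exact: height1].
Qed.

Lemma pair_height_ge1 v : 1 <= pair_height v.
Proof. by rewrite /pair_height mulr_ege1 ?height_ge1. Qed.

Lemma pair_heightM v w : pair_height (v * w) <= pair_height v * pair_height w.
Proof.
rewrite /pair_height [leRHS]mulrACA; apply: ler_pM;
  [exact/ltW/height_gt0|exact/ltW/height_gt0|exact: heightM|exact: heightM].
Qed.

Lemma pair_unitE (a b : L) :
  (((a, b) : L * L) \is a GRing.unit) = (a != 0) && (b != 0).
Proof. by rewrite -!unitfE. Qed.

Lemma pair_invE (a b : L) : a != 0 -> b != 0 -> ((a, b) : L * L)^-1 = (a^-1, b^-1).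
Proof.
move=> na nb; have u : ((a, b) : L * L) \is a GRing.unit by rewrite pair_unitE na nb.
by apply: (mulrI u); rewrite divrr //; apply: eqP; rewrite xpair_eqE /= !mulfV // !eqxx.
Qed.

Lemma pair_heightV v : v \is a GRing.unit -> pair_height v^-1 <= pair_height v.
Proof.
case: v => a b; rewrite pair_unitE => /andP[na nb]; rewrite pair_invE // /pair_height /=.
apply: ler_pM; [exact/ltW/height_gt0|exact/ltW/height_gt0|exact: heightV|exact: heightV].
Qed.

Lemma pair_height_sqr v : pair_height v ^+ 2 <= pair_height (v ^+ 2).
Proof.
rewrite /pair_height [leLHS]exprMn; apply: ler_pM;
  [exact/exprn_ge0/ltW/height_gt0|exact/exprn_ge0/ltW/height_gt0|exact: height_sqr|exact: height_sqr].
Qed.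

End PairNorm.

Lemma quadratic_count (Z m : nat) :
  (m %/ 16 <= Z)%N -> (7 * Z + Z * m <= 40 * Z ^ 2)%N.
Proof.
move=> mZ; have m_le : (m <= Z * 16 + 15)%N.
  rewrite {1}(divn_eq m 16) leq_add //; first by rewrite leq_mul2r mZ orbT.
  by rewrite -ltnS ltn_pmod.
have : (Z * m <= Z * (Z * 16 + 15))%N by rewrite leq_mul2l m_le orbT.
have : (Z <= Z * Z)%N by case: (Z) => // z; rewrite leq_pmulr.
by rewrite -mulnn; lia.
Qed.

Lemma card_fsetM_le (T : choiceType) (A B : {fset T}) :
  (#|` A `*` B| <= #|` A| * #|` B|)%N.
Proof.
rewrite -(size_allpairs pair); apply: uniq_leq_size (fset_uniq _) _ => -[x y].
rewrite in_fsetM => /andP[/= xA yB]; apply/allpairsP; by exists (x, y).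
Qed.

Lemma pairwise_neq (T : eqType) (R : rel T) (D : seq T) :
  pairwise R D -> {in D &, forall x y, x != y -> R x y || R y x}.
Proof.
elim: D => [|z D IHD] //= /andP[/allP zD /IHD{}IHD] x y.
rewrite !inE => /predU1P[->|xD] /predU1P[->|yD] xy.
- by rewrite eqxx in xy.
- by rewrite zD.
- by rewrite zD // orbT.
- exact: IHD.
Qed.

Lemma prod_pairX (L : fieldType) m (a b : nat -> L) (e : nat -> nat) :
  \prod_(i < m) ((a i, b i) : L * L) ^+ e i =
  (\prod_(i < m) a i ^+ e i, \prod_(i < m) b i ^+ e i).
Proof.
have pairX x y n : ((x, y) : L * L) ^+ n = (x ^+ n, y ^+ n).
  by elim: n => [|n IHn]; rewrite ?expr0 // !exprS IHn.
by elim: m => [|m IHm]; rewrite ?big_ord0 // !big_ord_recr /= IHm pairX.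
Qed.

(** Let [Z] be the integral 16th root of |Y^n|^2. A separated set has at most [Z] elements, so there
    are at most 7 Z solutions of small height, and at most [Z] others in each of at most 16 Z + 15
    scales; in total at most 40 Z^2. *)
Lemma solution_count : exists n C : nat, (0 < n)%N /\
  forall (L : fieldType) (G : finType) (s : G -> {rmorphism L -> algC})
    (conjpoly_rat : forall x, conjpoly s x \is a polyOver Crat) (g0 : G)
    (Y : {fset L}) (T : seq L),
  0 \notin Y -> uniq T -> {in T, forall x, x \in Y /\ x - 1 \in Y} ->
  (size T ^ 16 <= C * #|` powset Y n| ^ 4)%N.
Proof.
have [k [k3 k256]] := bernoulli_13_12.
(* [c] serves two bounds: [Q2 <= rho ^+ c] for the small solutions and 30 <= c for the large
   ones. *)
pose c := (14 * k)%N; have c30 : (30 <= c)%N by rewrite /c; lia.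
pose q := c.+1; have qc : (2 * c < 2 ^ q)%N.
  by rewrite expnS ltn_mul2l /= ltn_expl.
pose e i := ((2 ^ q) ^ i)%N; pose n := (\sum_(i < 16) e i)%N.
exists n, (40 ^ 16)%N; split.
  by rewrite /n big_ord_recl addn_gt0 /e expn0.
move=> L G s conjpoly_rat g0 Y T Y0 uT TY.
have [->|nzT] := eqVneq T [::]; first by rewrite exp0n.
have [t0 t0T] : exists t, t \in T by case: (T) nzT => // t; exists t; apply: mem_head.
have Y_gt0 : (0 < #|` Y|)%N.
  by rewrite cardfs_gt0; apply/fset0Pn; exists t0; have [] := TY _ t0T.
have nzY y : y \in Y -> y != 0 by apply: contraTneq => ->.
have nzx x : x \in T -> x != 0 by move=> /TY[/nzY].
have nzx1 x : x \in T -> x - 1 != 0 by move=> /TY[_ /nzY].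
pose N := pair_height conjpoly_rat.
have N1 : N 1 <= 1 := pair_height1 _.
have N_ge1 v : 1 <= N v := pair_height_ge1 _ _.
have NM v w : N (v * w) <= N v * N w := pair_heightM _ _ _.
have NV v (u : v \is a GRing.unit) : N v^-1 <= N v := pair_heightV _ u.
have Nsqr v : N v ^+ 2 <= N (v ^+ 2) := pair_height_sqr _ _.
have N_ge0 v : 0 <= N v by apply: le_trans (N_ge1 v).
have NR v : N v \is Num.real by apply: ger0_real.
pose v (x : L) : L * L := (x, x - 1).
have vU x : x \in T -> v x \is a GRing.unit.
  by move=> xT; rewrite /v pair_unitE nzx ?nzx1.
have NvE x y : x \in T -> N (v y / v x) =
    height conjpoly_rat (y / x) * height conjpoly_rat ((y - 1) / (x - 1)).
  by move=> xT; rewrite /N /v pair_invE; [ | exact: nzx | exact: nzx1].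
have NvC x y : x \in T -> y \in T -> N (v y / v x) <= N (v x / v y).
  move=> xT yT; rewrite -[v y / v x]invrK.
  apply: le_trans (NV _ _) _; first by rewrite unitrV unitrM unitrV !vU.
  by rewrite invrM ?unitrV ?vU // invrK mulrC.
pose P := powset Y n; pose PP : {fset L * L} := P `*` P.
have cPP (P' : {fset L}) : (#|` (P' `*` P' : {fset L * L})%fset| <= #|` P'| ^ 2)%N.
  by rewrite expnS expn1 card_fsetM_le.
have memPP (f : nat -> L) (e' : nat -> nat) m : (forall i, (i < m)%N -> f i \in T) ->
    \prod_(i < m) v (f i) ^+ e' i \in
      (powset Y (\sum_(i < m) e' i) `*` powset Y (\sum_(i < m) e' i) : {fset L * L}).
  move=> fT; rewrite [X in X \in _](prod_pairX m f (fun i => f i - 1) e') in_fsetM /=.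
  apply/andP; split.
    by apply: (@prod_powset _ Y m f e') => i im; have [] := TY _ (fT i im).
  apply: (@prod_powset _ Y m (fun i => f i - 1) e') => i im.
  by have [] := TY _ (fT i im).
have [Z [ZP Zmax]] := maximal_root (#|` P| ^ 2).
have pack (D : seq L) B : uniq D -> {subset D <= T} -> 1 < B ->
    {in D, forall x, N (v x) <= B} ->
    {in D &, forall x y, x != y -> B <= N (v x / v y) ^+ c} -> (size D <= Z)%N.
  move=> uD DT B1 DB Dsep; apply: Zmax; apply: leq_trans (cPP P).
  have nthT a : nth t0 D a \in T.
    by case: (ltnP a (size D)) => h; [apply/DT/mem_nth | rewrite nth_default].
  apply: (@packing _ _ N N1 N_ge1 NM NV Nsqr 16 (size D) q c B
            (fun a => v (nth t0 D a))) => //.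
  - by rewrite /c; lia.
  - by move=> a; apply: vU.
  - by move=> a ak; apply/DB/mem_nth.
  - by move=> a b ak bk ab; apply: Dsep; rewrite ?mem_nth // nth_uniq.
  - by move=> f fk; apply: (memPP (fun i => nth t0 D (f i)) e).
have d_gt0 : (0 < #|G|)%N by apply/card_gt0P; exists g0.
set d := #|G| in d_gt0.
(* 6 * r ^ 14 = 13 / 2 < 7, as height_cluster requires. *)
pose r : algC := 14.-root (13%:R / 12%:R).
have r14 : r ^+ 14 = 13%:R / 12%:R by rewrite rootCK.
have r1 : 1 < r by rewrite rootC_gt1 // ltr_pdivlMr ?ltr0n // mul1r ltr_nat.
pose rho := r ^+ d.
have rho1 : 1 < rho by rewrite exprn_egt1 // -lt0n.
have small : 6 ^+ d * rho ^+ 14 < 7 ^+ d.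
  rewrite /rho -exprM mulnC exprM r14 -exprMn ltrXn2r -?lt0n //.
    by rewrite mulr_ge0 ?divr_ge0.
  by rewrite mulrA ltr_pdivrMr ?ltr0n // -!natrM ltr_nat.
pose Q : algC := 16 ^+ d; pose Q2 := Q ^+ 2.
have Q1 : 1 < Q by rewrite exprn_egt1 -?lt0n // ltr1n.
have Q0 : 0 <= Q := ltW (lt_trans ltr01 Q1).
have Q21 : 1 < Q2 by rewrite exprn_egt1.
have rhoc : Q2 <= rho ^+ c.
  have -> : Q2 = 256 ^+ d.
    by rewrite /Q2 /Q -exprM mulnC exprM -natrX.
  have -> : rho ^+ c = ((13%:R / 12%:R) ^+ k) ^+ d.
    by rewrite -r14 /rho /c -!exprM; congr (_ ^+ _); rewrite mulnC mulnA.
  by rewrite lerXn2r // nnegrE // exprn_ge0 // divr_ge0.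
pose small_sol := [seq x <- T | N (v x) <= Q2].
pose large_sol := [seq x <- T | ~~ (N (v x) <= Q2)].
have small_le : (size small_sol <= 7 * Z)%N.
  pose near x y := N (v y / v x) <= rho.
  have sT : {subset small_sol <= T} by move=> x; rewrite mem_filter => /andP[].
  have usm : uniq small_sol by apply: filter_uniq.
  have [x xs|x /sT xT|D [uD Ds szD pD]] := @greedy_separated _ near 7 _ usm.
  - apply: (@height_cluster _ _ _ conjpoly_rat x _ rho) => //.
    + by rewrite -(fmorph_eq0 (s g0)) rmorph_nat pnatr_eq0.
    + exact/nzx/sT.
    + exact/nzx1/sT.
    + exact: filter_uniq.
    + by move=> y; rewrite mem_filter /near NvE ?sT // => /andP[].
  - by rewrite /near divrr ?vU //; apply: le_trans N1 (ltW rho1).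
  apply: leq_trans szD _; rewrite leq_mul2l /=.
  have DT x : x \in D -> x \in T by move=> /Ds/sT.
  apply: (pack D Q2) => // [x /Ds|x y xD yD xy].
    by rewrite mem_filter => /andP[].
  apply: le_trans rhoc _; apply: lerXn2r; rewrite ?nnegrE ?N_ge0 //.
    exact/ltW/(lt_trans ltr01 rho1).
  have rR : rho \is Num.real by apply: ger0_real; apply/ltW/(lt_trans ltr01 rho1).
  have := pairwise_neq pD xD yD xy.
  rewrite /near -!real_ltNge // => /orP[/ltW h|/ltW //].
  by apply: le_trans h _; apply: NvC; apply: DT.
have lT : {subset large_sol <= T} by move=> x; rewrite mem_filter => /andP[].
have Q2R : Q2 \is Num.real by apply: ger0_real; apply/ltW/(lt_trans ltr01 Q21).
have large_gt x : x \in large_sol -> Q2 < N (v x).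
  by rewrite mem_filter -real_ltNge // => /andP[].
have ul : uniq large_sol by apply: filter_uniq.
have [x xl|D [Dl szD pD]] := @lacunary_subsequence _ _ (fun x => N (v x)) Z _ ul
  (fun x => N_ge1 (v x)).
  apply: (pack _ (N (v x) ^+ 5)).
  - exact: filter_uniq.
  - by move=> y; rewrite mem_filter => /andP[_ /lT].
  - by rewrite exprn_egt1 // (lt_trans Q21) ?large_gt.
  - by move=> y; rewrite mem_filter => /andP[/andP[_]].
  move=> y z; rewrite [y \in _]mem_filter [z \in _]mem_filter => /andP[/andP[xy _] yl] /andP[_ zl] yz.
  set M := N (v y / v z).
  have M1 : 1 <= M by apply: N_ge1.
  have gap : N (v y) <= Q * M ^+ 3.
    apply: le_trans (_ : Q * N (v z / v y) ^+ 3 <= _).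
      rewrite NvE ?lT //; have [yT zT] := (lT _ yl, lT _ zl).
      exact: (height_gap conjpoly_rat (nzx _ yT) (nzx1 _ yT) (nzx _ zT) (nzx1 _ zT) yz).
    rewrite ler_wpM2l ?(ltW (lt_trans ltr01 Q1)) //.
    by apply: lerXn2r; rewrite ?nnegrE ?N_ge0 //; apply: NvC; apply: lT.
  (* Squaring [gap] gives N^2 <= Q^2 M^6, and Q^2 < N for a large solution. *)
  have N6 : N (v y) <= M ^+ 6.
    have Ny0 : 0 < N (v y) by apply: lt_le_trans ltr01 (N_ge1 _).
    rewrite -(ler_pM2l Ny0); apply: (@le_trans _ _ (Q2 * M ^+ 6)).
      rewrite /Q2 (_ : 6%N = (3 * 2)%N) // exprM -exprMn -expr2.
      by apply: lerXn2r => //; rewrite nnegrE ?N_ge0 // mulr_ge0 ?exprn_ge0 ?N_ge0 ?Q0.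
    by rewrite ler_wpM2r ?exprn_ge0 ?N_ge0 // ltW // large_gt.
  apply: (@le_trans _ _ ((M ^+ 6) ^+ 5)).
    by apply: lerXn2r; rewrite ?nnegrE ?exprn_ge0 ?N_ge0 //; apply: le_trans xy N6.
  by rewrite -exprM ler_weXn2l.
(* [D] is cut into 16 blocks of equal length, leaving at most 15 terms over. *)
have szD16 : (size D %/ 16 <= Z)%N.
  apply: Zmax; apply: (@leq_trans (#|` powset Y 16| ^ 2)); last first.
    rewrite leq_exp2r //; apply: card_powset_mono => //.
    rewrite /n -[16%N in X in (X <= _)%N]card_ord -sum1_card leq_sum // => i _.
    by rewrite /e !expn_gt0.
  apply: leq_trans (cPP _).
  have nthT a : nth t0 D a \in T.
    by case: (ltnP a (size D)) => h; [apply/lT/Dl/mem_nth | rewrite nth_default].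
  apply: (@lacunary _ _ N N1 N_ge1 NM NV 16 (size D %/ 16)
            (fun a => v (nth t0 D a))) => //.
  - by move=> a; apply: vU.
  - move=> a b ab b16; have bD : (b < size D)%N.
      by apply: leq_trans b16 _; rewrite mulnC leq_trunc_div.
    by move/(pairwiseP t0): pD; apply; rewrite ?inE // (ltn_trans ab).
  - move=> f fk; have := memPP (fun i => nth t0 D (i * (size D %/ 16) + f i)%N) (fun=> 1%N) 16.
    rewrite sum_nat_const card_ord muln1; apply=> i _; exact: nthT.
have szT : (size T <= 40 * Z ^ 2)%N.
  rewrite -(count_predC (fun x => N (v x) <= Q2)) -!size_filter -/small_sol -/large_sol.
  apply: leq_trans (leq_add small_le szD) _.
  exact: quadratic_count szD16.
apply: (@leq_trans ((40 * Z ^ 2) ^ 16)%N); first by rewrite leq_exp2r.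
rewrite expnMn leq_mul2l; apply/orP; right.
rewrite -expnM mulnC expnM (_ : 4%N = (2 * 2)%N) // expnM leq_exp2r //.
Qed.

(** * Growth of sumsets *)

(** The flag treats products and ratios together. *)
Definition qop (F : fieldType) (b : bool) (x y : F) : F := if b then x * y else x / y.

Definition quot (F : fieldType) (b : bool) (S : {fset F}) : {fset F} :=
  [fset qop b x y | x in S, y in S].

Lemma quotP (F : fieldType) b (S : {fset F}) z :
  reflect (exists x y, [/\ x \in S, y \in S & z = qop b x y]) (z \in quot b S).
Proof.
apply: (iffP (imfset2P _ _ _ _ _)) => [[x /= xS [y /= yS ->]]|[x [y [xS yS ->]]]].
  by exists x, y.
by exists x => //; exists y.
Qed.

(* S is the nonzero part of a set containing the translates A + u and A + v. *)
Definition growth (e C : nat) (F : fieldType) : Prop :=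
  forall (b : bool) (A S : {fset F}) (u v : F), 0 \notin S -> u != v ->
  {in A, forall x, (x + u = 0 \/ x + u \in S) /\ (x + v = 0 \/ x + v \in S)} ->
  (#|` S| <= #|` A| ^ 2)%N -> (3 <= #|` A|)%N ->
  (#|` A| ^ 8 * #|` S| ^ e <= C * #|` quot b S| ^ e)%N.

(** Here p stands for |Y^n|, and a <= 3 t. Multiply a^16 <= B C p^4 by s^(4n), bound p^4 s^(4n) by
    P^(4n) s^4 and s^4 by a^8, then cancel a^8. *)
Lemma growth_arith (a s t p P n C B : nat) : B = (3 ^ 16)%N -> (3 <= a)%N -> (a - 2 <= t)%N ->
  (s <= a ^ 2)%N -> (t ^ 16 <= C * p ^ 4)%N -> (p * s ^ n <= P ^ n * s)%N ->
  (a ^ 8 * s ^ (4 * n) <= (B * C) * P ^ (4 * n))%N.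
Proof.
move=> DB a3 at2 sa tC pP.
have a8 : (0 < a ^ 8)%N by rewrite expn_gt0 (leq_trans _ a3).
rewrite -(leq_pmul2r a8) mulnAC -expnD.
have aC : (a ^ 16 <= B * C * p ^ 4)%N.
  apply: (@leq_trans ((3 * t) ^ 16)%N); first by rewrite leq_exp2r //; lia.
  by rewrite expnMn -DB -mulnA leq_mul2l tC orbT.
clear DB; apply: (leq_trans (leq_mul aC (leqnn _))).
rewrite -[X in (X <= _)%N]mulnA -[X in (_ <= X)%N]mulnA leq_mul2l; apply/orP; right.
have e4 z : (z ^ (4 * n) = (z ^ n) ^ 4)%N by rewrite mulnC expnM.
rewrite !e4 -expnMn.
apply: (@leq_trans ((P ^ n * s) ^ 4)%N); first by rewrite leq_exp2r.
rewrite expnMn leq_mul2l; apply/orP; right.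
by rewrite (_ : 8%N = (2 * 4)%N) // expnM leq_exp2r.
Qed.

(** Division by u - v turns x + u and x + v into numbers of difference 1. [X] consists of the
    elements of [S] or of their inverses, so that XY lies in a multiple of [quot b S]. *)
Lemma growth_number_field : exists n C : nat, (0 < n)%N /\
  forall (L : fieldType) (G : finType) (s : G -> {rmorphism L -> algC}) (g0 : G),
  (forall x, conjpoly s x \is a polyOver Crat) -> growth (4 * n) C L.
Proof.
have [n [C [n_gt0 count]]] := solution_count.
have [B DB] : exists B, B = (3 ^ 16)%N by exists (3 ^ 16)%N.
exists n, (B * C)%N; split=> //.
move=> L G s g0 conjpoly_rat b A S u v S0 uv AS sA A3.
pose d := u - v; have nzd : d != 0 by rewrite subr_eq0.
have nzdV : d^-1 != 0 by rewrite invr_eq0.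
pose Y := [fset (d^-1 * x)%R | x in S].
have Y0 : 0 \notin Y.
  apply/imfsetP => -[x /= xS /esym/eqP]; rewrite mulf_eq0 (negPf nzdV) /= => /eqP x0.
  by rewrite -x0 xS in S0.
(* Both translates of the remaining elements are nonzero, hence in [S]. *)
pose A' := (A `\ (- u)) `\ (- v).
have A'A x : x \in A' -> [/\ x \in A, x + u != 0 & x + v != 0].
  by rewrite !inE => /and3P[xv xu xA]; split; rewrite // addr_eq0.
have A'sz : (#|` A| - 2 <= #|` A'|)%N.
  rewrite (cardfsD1 (- u) A) (cardfsD1 (- v) (A `\ (- u))).
  rewrite -/A' addnA leq_subLR leq_add2r.
  by case: (- u \in A); case: (- v \in A `\ (- u)).
pose T := [seq d^-1 * (x + u) | x <- enum_fset A'].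
have szT : size T = #|` A'| by rewrite size_map.
have uT : uniq T by rewrite map_inj_uniq ?fset_uniq // => x y /(mulfI nzdV)/addIr.
have TY : {in T, forall x, x \in Y /\ x - 1 \in Y}.
  move=> _ /mapP[x xA' ->]; have [xA xu xv] := A'A x xA'.
  have [[/eqP xu0|xuS] xvS] := AS x xA; first by rewrite xu0 in xu.
  case: xvS => [/eqP xv0|xvS]; first by rewrite xv0 in xv.
  split; first by apply/imfsetP; exists (x + u).
  apply/imfsetP; exists (x + v) => //=.
  by rewrite -[1](mulVf nzd) -mulrBr; congr (_ * _); rewrite /d; ring.
have := count L G s conjpoly_rat g0 Y T Y0 uT TY; rewrite szT => cnt.
pose X := if b then S else [fset x^-1 | x in S].
have cX : #|` X| = #|` S|.
  by rewrite /X; case: (b) => //; apply: card_imfset; apply: invr_inj.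
have X0 : 0 \notin X.
  rewrite /X; case: (b) => //; apply/imfsetP => -[x /= xS /esym/eqP].
  by rewrite invr_eq0 => /eqP x0; rewrite -x0 xS in S0.
have S_gt0 : (0 < #|` S|)%N.
  have : (0 < #|` A'|)%N by apply: leq_trans A'sz; lia.
  rewrite cardfs_gt0 => /fset0Pn[x /A'A[xA xu xv]].
  have [[/eqP xu0|xuS] _] := AS x xA; first by rewrite xu0 in xu.
  by rewrite cardfs_gt0; apply/fset0Pn; exists (x + u).
have XY : (#|` mulset X Y| <= #|` quot b S|)%N.
  rewrite -(card_scale (quot b S) nzdV); apply: fsubset_leq_card.
  apply/fsubsetP => _ /mulsetP[x [_ [xX /imfsetP[y /= yS ->] ->]]].
  rewrite mulrCA; apply/imfsetP; exists (x * y) => //=.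
  apply/quotP; move: xX; rewrite /X /qop; case: (b) => [xS|/imfsetP[z /= zS ->]].
    by exists x, y.
  by exists y, z; rewrite mulrC.
have X_gt0 : (0 < #|` X|)%N by rewrite cX.
have pl := plunnecke n X0 Y0 X_gt0; rewrite cX in pl.
apply: (growth_arith DB A3 A'sz sA cnt); apply: leq_trans pl _.
rewrite leq_mul2r; apply/orP; right.
by case: (n) => // k; rewrite leq_exp2r.
Qed.

Lemma growth_algC : exists e C : nat, (0 < e)%N /\ growth e C algC.
Proof.
have [n [C [n_gt0 gL]]] := growth_number_field; exists (4 * n)%N, C.
split; first by rewrite muln_gt0.
move=> b A S u v S0 uv AS sA A3.
pose t := u :: v :: enum_fset A ++ enum_fset S.
have [L [G [s [g0 [t' [conjpoly_rat Dt]]]]]] := galois_number_field t.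
pose f := s g0; have f_inj : injective f by apply: fmorph_inj.
have lift x : x \in t -> exists2 y, y \in t' & f y = x.
  by rewrite -Dt => /mapP[y yt ->]; exists y.
have [u' _ Du] := lift u (mem_head _ _).
have [|v' _ Dv] := lift v; first by rewrite !inE eqxx orbT.
pose pull (B : {fset algC}) := [fset x in t' | f x \in B]%fset.
have pullE (B : {fset algC}) : {subset B <= t} -> f @` pull B = B.
  move=> Bt; apply/fsetP => x; apply/imfsetP/idP => [[y /=]|xB].
    by rewrite !inE => /andP[_ fyB] ->.
  have [y yt Dy] := lift x (Bt x xB); exists y => //=.
  by rewrite !inE yt Dy.
have cpull B : {subset B <= t} -> #|` pull B| = #|` B|.
  by move=> Bt; rewrite -[in RHS](pullE B Bt); apply/esym/card_imfset/f_inj.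
have At : {subset A <= t} by move=> x xA; rewrite !inE mem_cat xA !orbT.
have St : {subset S <= t} by move=> x xS; rewrite !inE mem_cat xS !orbT.
have memp B x : x \in pull B -> f x \in B by rewrite !inE => /andP[].
have pmem (B : {fset algC}) x : {subset B <= t} -> f x \in B -> x \in pull B.
  move=> Bt fxB; have [y yt Dy] := lift _ (Bt _ fxB).
  by rewrite !inE fxB andbT -(f_inj _ _ Dy).
have := gL L G s g0 conjpoly_rat b (pull A) (pull S) u' v'.
rewrite !cpull //; move=> /(_ _ _ _ sA A3) h.
apply: (leq_trans (h _ _ _)).
- by apply/negP => /memp; rewrite rmorph0; apply/negP.
- by apply: contraNneq uv => uv'; rewrite -Du -Dv uv'.
- move=> x xA; have [hu hv] := AS _ (memp _ _ xA).
  split.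
    move: hu; rewrite -Du -rmorphD => -[/eqP|/pmem hS]; last by right; apply: hS.
    by rewrite fmorph_eq0 => /eqP; left.
  move: hv; rewrite -Dv -rmorphD => -[/eqP|/pmem hS]; last by right; apply: hS.
  by rewrite fmorph_eq0 => /eqP; left.
rewrite leq_mul2l; apply/orP; right.
suff qle : (#|` quot b (pull S)| <= #|` quot b S|)%N.
  by case: (4 * n)%N => // k; rewrite leq_exp2r.
have <- : #|` [fset f x | x in quot b (pull S)]| = #|` quot b (pull S)|.
  exact: card_imfset.
apply: fsubset_leq_card.
apply/fsubsetP => _ /imfsetP[_ /= /quotP[x [y [xS yS ->]]] ->]; apply/quotP.
exists (f x), (f y); split; [exact: memp|exact: memp|].
by rewrite /qop; case: (b); rewrite ?rmorphM ?fmorphV.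
Qed.

(** The value f x y determines g (p x) (p y), so [P2] lies in the image of [P1] under a map, whose
    value elsewhere is [k0]. *)
Lemma card_fset2_le (T1 T2 : choiceType) (K1 K2 : choiceType) (S1 : {fset T1})
    (p : T1 -> T2) (f : T1 -> T1 -> K1) (g : T2 -> T2 -> K2)
    (P1 : {fset K1}) (P2 : {fset K2}) (k0 : K2) :
  {in S1 &, forall x y, f x y \in P1} ->
  (forall z, z \in P2 -> exists x y, [/\ x \in S1, y \in S1 & z = g (p x) (p y)]) ->
  (forall x y z w, x \in S1 -> y \in S1 -> z \in S1 -> w \in S1 ->
     f x y = f z w -> g (p x) (p y) = g (p z) (p w)) ->
  (#|` P2| <= #|` P1|)%N.
Proof.
move=> fP gP fg.
have /choice[h hP] : forall q, exists z, forall x y, x \in S1 -> y \in S1 ->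
    f x y = q -> g (p x) (p y) = z.
  move=> q; have [[x [y [xS yS Dq]]]|no] := pselect (exists x y, [/\ x \in S1, y \in S1 & f x y = q]).
    by exists (g (p x) (p y)) => z w zS wS; rewrite -Dq => /fg ->.
  by exists k0 => x y xS yS Dq; case: no; exists x, y.
apply: (@leq_trans #|` [fset h x | x in P1]|); last exact: leq_imfset_card.
apply: fsubset_leq_card.
apply/fsubsetP => _ /gP[x [y [xS yS ->]]]; apply/imfsetP; exists (f x y) => /=.
  exact: fP.
exact: hP.
Qed.

(** A specialization injective on [E] preserves the sizes of [A] and [S] and the sums involved, and
    it keeps equal products and ratios equal, so the set [quot] cannot grow. *)
Lemma growth_transfer (e C : nat) (K : numFieldType) : growth e C algC -> growth e C K.
Proof.
move=> gC b A S u v S0 uv AS sA A3.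
pose E := 0 :: u :: v :: enum_fset A ++ enum_fset S.
have [R [ev [specR evE]]] := specializable_cover E.
have /choice[pre preP] : forall x, exists r, x \in E -> ev r = x.
  move=> x; have [xE|/negP xE] := boolP (x \in E); last by exists 0.
  by have [r Dr] := evE x xE; exists r.
(* Keeping [F] nonzero means injectivity on [E], which contains 0 so that nonzero elements stay
   nonzero. *)
pose F := \prod_(x <- E) \prod_(y <- E) (if x == y then 1 else pre x - pre y).
have evF : ev F != 0.
  rewrite /F rmorph_prod prodf_seq_neq0; apply/allP => x xE /=.
  rewrite rmorph_prod prodf_seq_neq0; apply/allP => y yE /=.
  case: (x =P y) => [_|/eqP xy] /=; first by rewrite (rmorph1 ev) oner_neq0.
  by rewrite rmorphB /= !preP // subr_eq0.
have [phi [nzphi ker]] := specR ev F evF.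
pose psi x := phi (pre x).
have psi_inj : {in E &, injective psi}.
  move=> x y xE yE exy; apply/eqP; apply: contraNT nzphi => xy.
  rewrite /F rmorph_prod prodf_seq_eq0; apply/hasP; exists x => //=.
  rewrite rmorph_prod prodf_seq_eq0; apply/hasP; exists y => //=.
  by rewrite (negPf xy) rmorphB subr_eq0; apply/eqP.
have psi_rel r1 r2 : ev r1 = ev r2 -> phi r1 = phi r2.
  move=> e12; apply/eqP; rewrite -subr_eq0 -rmorphB; apply/eqP/ker.
  by rewrite rmorphB e12 subrr.
have E0 : 0 \in E by rewrite mem_head.
have psi0 : psi 0 = 0 by rewrite -(rmorph0 phi); apply: psi_rel; rewrite preP ?rmorph0.
have psiD x y : x \in E -> y \in E -> x + y \in E -> psi (x + y) = psi x + psi y.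
  by move=> xE yE xyE; rewrite -rmorphD; apply: psi_rel; rewrite rmorphD !preP.
have AE : {subset A <= E} by move=> x xA; rewrite !inE mem_cat xA !orbT.
have SE : {subset S <= E} by move=> x xS; rewrite !inE mem_cat xS !orbT.
have uE : u \in E by rewrite !inE eqxx !orbT.
have vE : v \in E by rewrite !inE eqxx !orbT.
have cimg (B : {fset K}) : {subset B <= E} -> #|` [fset psi x | x in B]| = #|` B|.
  by move=> BE; apply: card_in_imfset => x y /BE xE /BE yE; apply: psi_inj.
have cA := cimg A AE; have cS := cimg S SE.
have := gC b [fset psi x | x in A] [fset psi x | x in S] (psi u) (psi v).
rewrite cA cS => /(_ _ _ _ sA A3) h; apply: (leq_trans (h _ _ _)).
- apply/imfsetP => -[x /= xS]; rewrite -psi0 => /(psi_inj _ _ E0 (SE _ xS)) x0.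
  by rewrite x0 xS in S0.
- by apply: contraNneq uv => /(psi_inj _ _ uE vE) ->.
- move=> _ /imfsetP[x /= xA ->]; have [hu hv] := AS x xA.
  have aux w : w \in E -> x + w = 0 \/ x + w \in S ->
      psi x + psi w = 0 \/ psi x + psi w \in [fset psi x | x in S].
    move=> wE hw; have xE := AE x xA; case: hw => [xw0|xwS].
      by left; rewrite -psiD // xw0.
    by right; rewrite -psiD //; [apply/imfsetP; exists (x + w) | exact: SE].
  by split; apply: aux.
rewrite leq_mul2l; apply/orP; right.
suff qle : (#|` quot b [fset psi x | x in S]| <= #|` quot b S|)%N.
  by case: (e) => // k; rewrite leq_exp2r.
apply: (@card_fset2_le _ _ _ _ S psi (qop b) (qop b) _ _ 0).
- by move=> x y xS yS; apply/quotP; exists x, y.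
- move=> z /quotP[_ [_ [/imfsetP[x /= xS ->] /imfsetP[y /= yS ->] ->]]].
  by exists x, y.
have nzS x : x \in S -> x != 0 by apply: contraTneq => ->.
have nzpsi x : x \in S -> psi x != 0.
  move=> xS; apply: contraNneq (nzS x xS); rewrite -psi0 => /psi_inj -> //.
  exact: SE.
move=> x y z w xS yS zS wS; rewrite /qop; case: (b) => exy.
  by rewrite -!rmorphM; apply: psi_rel; rewrite !rmorphM !preP ?SE.
apply/eqP; rewrite eqr_div ?nzpsi //; apply/eqP.
rewrite -!rmorphM; apply: psi_rel; rewrite !rmorphM !preP ?SE //.
by apply/eqP; rewrite -eqr_div ?nzS //; apply/eqP.
Qed.

(** * From a power saving to the stated bound *)

Section RealBounds.

Variable R : realType.

(** If ln n >= 1, then p <= 1 suffices. The finitely many other n are absorbed by [F0], also for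
    negative [p]. *)
Lemma powR_ln_le (p : R) : p <= 1 -> exists2 F0 : R, 0 <= F0 &
  forall n : nat, (0 < n)%N -> powR (ln n%:R) p <= F0 + ln n%:R.
Proof.
move=> p1; pose N := Num.bound (expR 1 : R).
have eN : expR 1 < N%:R :> R by apply: archi_boundP; apply: expR_ge0.
exists (\sum_(i < N) powR (ln (i : nat)%:R) p); first by apply: sumr_ge0 => i _; apply: powR_ge0.
move=> n n_gt0; have ln_ge0' : 0 <= ln n%:R :> R by rewrite ln_ge0 // ler1n.
have [ln1|ln1] := leP 1 (ln n%:R : R).
  apply: le_trans (ler_powR ln1 p1) _; rewrite powRr1 // lerDr.
  by apply: sumr_ge0 => i _; apply: powR_ge0.
have nN : (n < N)%N.
  rewrite -(ltr_nat R); apply: lt_trans eN.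
  by rewrite -[ltLHS]lnK ?posrE ?ltr0n // ltr_expR.
rewrite -[leLHS]addr0 lerD // (bigD1 (Ordinal nN)) //= lerDl.
by apply: sumr_ge0 => i _; apply: powR_ge0.
Qed.

(** An e-th root is taken; C <= (C + 1)^e avoids the root of [C]. *)
Lemma root_bound (e : nat) (s n C K : R) : (0 < e)%N -> 0 <= s -> 1 <= n ->
  0 <= C -> 0 < K -> n * s ^+ e <= C * (K * n ^+ 2) ^+ e ->
  s <= (C + 1) * K * n ^+ 2 * expR (- (e%:R^-1 * ln n)).
Proof.
move=> e0 s0 n1 C0 K0 h.
have n0 : 0 < n by apply: lt_le_trans n1.
rewrite -(@ler_pXn2r _ e) ?nnegrE //; last first.
  by rewrite !mulr_ge0 ?expR_ge0 ?exprn_ge0 ?addr_ge0 // ltW.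
rewrite exprMn -mulrA exprMn -expRM_natl mulrN mulVKf ?pnatr_eq0 -?lt0n //.
rewrite expRN lnK ?posrE // ler_pdivlMr // mulrC; apply: le_trans h _.
rewrite ler_wpM2r //.
  by rewrite exprn_ge0 // mulr_ge0 ?exprn_ge0 // ltW.
apply: (@le_trans _ _ (C + 1)); first by rewrite lerDl.
by apply: ler_eXnr => //; rewrite lerDr.
Qed.

End RealBounds.

(** [t] is the identity for sums and the negation for differences. The saving n^(-1/e) implies the
    stated one by [powR_ln_le], at the price of a constant factor. *)
Lemma growth_bound (R : realType) (eps K : R) : 0 < eps -> 0 < K ->
  exists C C1 : R, 0 < C /\ 0 < C1 /\
  forall (b : bool) (A D : {fset R[i]}) (t : R[i] -> R[i]), injective t ->
    {in A &, forall x a, x + t a \in D} -> (#|` D| <= #|` A| ^ 2)%N ->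
    (#|` quot b (D `\ 0)|)%:R <= K * (#|` A|)%:R ^+ 2 ->
    (#|` D|)%:R <= bound C C1 eps #|` A|.
Proof.
move=> eps0 K0; have [e [Cn [e0 gC]]] := growth_algC.
have p1 : 3^-1 - eps <= 1 by lra.
have [F0 F00 F0P] := powR_ln_le p1.
pose c : R := e%:R^-1; have c0 : 0 < c by rewrite invr_gt0 ltr0n.
have c1 : c <= 1 by rewrite invf_le1 ?ltr0n // ler1n.
(* The summand 3 covers sets [A] with fewer than three elements, and the element 0 of [D]. *)
pose B : R := (Cn%:R + 1) * K + 3.
have B0 : 0 < B by rewrite addr_gt0 // mulr_gt0 // ltr_wpDl.
exists c, (B * expR (c * F0)); split=> //; split; first by rewrite mulr_gt0 ?expR_gt0.
move=> b A D t t_inj tD szD qK; set n := #|` A| in szD qK *.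
have [n0|n_gt0] := posnP n.
  by move: szD; rewrite n0 leqn0 => /eqP ->; rewrite /bound expr0n /= mulr0 mul0r.
have n1 : 1 <= n%:R :> R by rewrite ler1n.
have nR0 : 0 < n%:R :> R by rewrite ltr0n.
have inv_n : n%:R^-1 <= expR (- (c * ln n%:R)) :> R.
  rewrite -[X in X^-1]lnK ?posrE // -expRN ler_expR lerN2 ler_piMl //.
  by rewrite ln_ge0.
suff main : (#|` D|)%:R <= B * n%:R ^+ 2 * expR (- (c * ln n%:R)).
  apply: le_trans main _; rewrite /bound.
  rewrite [leRHS](_ : _ = B * n%:R ^+ 2 * (expR (c * F0) *
    expR (- (c * powR (ln n%:R) (3^-1 - eps))))); last by ring.
  rewrite ler_pM2l ?mulr_gt0 ?exprn_gt0 // -expRD ler_expR.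
  rewrite -!mulrN -mulrDr ler_pM2l //.
  by have := F0P n n_gt0; lra.
have sq_ge : 1 <= n%:R ^+ 2 * expR (- (c * ln n%:R)) :> R.
  apply: (@le_trans _ _ (n%:R ^+ 2 / n%:R)); first by rewrite expr2 mulfK ?gt_eqF.
  by rewrite ler_wpM2l ?exprn_ge0.
have [n3|n_lt3] := leqP 3 n; last first.
  apply: (@le_trans _ _ (n%:R ^+ 2)); first by rewrite -natrX ler_nat.
  rewrite mulrAC ler_peMl ?exprn_ge0 //; apply: (@le_trans _ _ (3 * n%:R^-1)).
    by rewrite ler_pdivlMr // mul1r ler_nat ltnW.
  apply: ler_pM; rewrite ?invr_ge0 //.
  by rewrite /B lerDr mulr_ge0 ?addr_ge0 // ltW.
have [a [a' [aA a'A aa']]] : exists a a', [/\ a \in A, a' \in A & a != a'].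
  have : (0 < #|` A|)%N by [].
  rewrite cardfs_gt0 => /fset0Pn[a aA].
  have : (0 < #|` A `\ a|)%N.
    by move: n3; rewrite /n (cardfsD1 a A) aA add1n ltnS; apply: leq_trans.
  rewrite cardfs_gt0 => /fset0Pn[a']; rewrite !inE => /andP[a'a a'A].
  by exists a, a'; split; rewrite // eq_sym.
pose S := D `\ 0.
have S0 : 0 \notin S by rewrite !inE eqxx.
have sS : (#|` S| <= n ^ 2)%N.
  by apply: leq_trans szD; apply: fsubset_leq_card; apply: fsubD1set.
have AS : {in A, forall x, (x + t a = 0 \/ x + t a \in S) /\
                           (x + t a' = 0 \/ x + t a' \in S)}.
  move=> x xA; split.
    have [->|nz] := eqVneq (x + t a) 0; first by left.
    by right; rewrite !inE nz tD.
  have [->|nz] := eqVneq (x + t a') 0; first by left.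
  by right; rewrite !inE nz tD.
have taa' : t a != t a' by rewrite (inj_eq t_inj).
have gr := @growth_transfer e Cn _ gC b A S (t a) (t a') S0 taa' AS sS n3.
have sb : (#|` S|)%:R <= (Cn%:R + 1) * K * n%:R ^+ 2 * expR (- (c * ln n%:R)).
  apply: root_bound => //.
  apply: (@le_trans _ _ ((n ^ 8 * #|` S| ^ e)%N%:R)).
    rewrite -natrX -natrM ler_nat leq_mul2r; apply/orP; right.
    by rewrite -{1}(expn1 n) leq_pexp2l.
  apply: (@le_trans _ _ ((Cn * #|` quot b S| ^ e)%N%:R)); first by rewrite ler_nat.
  rewrite natrM natrX ler_wpM2l //; apply: lerXn2r; rewrite ?nnegrE //.
  by rewrite mulr_ge0 ?exprn_ge0 // ltW.
have DS : (#|` D| <= #|` S| + 1)%N.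
  by rewrite (cardfsD1 0 D) addnC leq_add2l leq_b1.
apply: (@le_trans _ _ ((#|` S|)%:R + 1)); first by rewrite natr1 ler_nat -addn1.
apply: le_trans (lerD sb sq_ge) _.
rewrite -[X in X + _ <= _]mulrA -[X in _ <= X]mulrA [leRHS]mulrDl lerD2l.
by rewrite ler_peMl ?ler1n // (le_trans ler01).
Qed.

Lemma card_imfset2_sqr (K : choiceType) (f : K -> K -> K) (A : {fset K}) :
  (#|` [fset f a b | a in A, b in A]| <= #|` A| ^ 2)%N.
Proof.
rewrite expnS expn1 -(size_allpairs f); apply: uniq_leq_size (fset_uniq _) _ => z.
case/imfset2P => a /= aA [b /= bA ->]; exact: allpairs_f.
Qed.


Theorem theorem3p1 (R : realType) (eps K : R) :
  0 < eps -> 0 < K ->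
  exists C C1 : R, 0 < C /\ 0 < C1 /\
  forall A : {fset R[i]},
    [/\ ((#|` ratioset (sumset A)|)%:R <= K * (#|` A|)%:R ^+ 2 ->
           (#|` sumset A|)%:R <= bound C C1 eps #|` A|),
        ((#|` prodset (sumset A) (sumset A)|)%:R <= K * (#|` A|)%:R ^+ 2 ->
           (#|` sumset A|)%:R <= bound C C1 eps #|` A|),
        ((#|` ratioset (diffset A)|)%:R <= K * (#|` A|)%:R ^+ 2 ->
           (#|` diffset A|)%:R <= bound C C1 eps #|` A|) &
        ((#|` prodset (diffset A) (diffset A)|)%:R <= K * (#|` A|)%:R ^+ 2 ->
           (#|` diffset A|)%:R <= bound C C1 eps #|` A|)].
Proof.
move=> eps0 K0; have [C [C1 [C0 [C10 main]]]] := growth_bound eps0 K0.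
exists C, C1; split=> //; split=> // A.
have sumD : {in A &, forall x a, x + id a \in sumset A}.
  by move=> x a xA aA; apply/imfset2P; exists x => //; exists a.
have diffD : {in A &, forall x a, x + - a \in diffset A}.
  by move=> x a xA aA; apply/imfset2P; exists x => //; exists a.
have sum_sz : (#|` sumset A| <= #|` A| ^ 2)%N := card_imfset2_sqr _ _.
have diff_sz : (#|` diffset A| <= #|` A| ^ 2)%N := card_imfset2_sqr _ _.
have ratio_le (D : {fset R[i]}) : (#|` quot false (D `\ 0%R)| <= #|` ratioset D|)%N.
  apply: fsubset_leq_card; apply/fsubsetP => _ /quotP[x [y [xD yD ->]]].
  move: xD yD; rewrite !in_fsetD1 => /andP[_ xD] /andP[ny yD].
  by apply/imfset2P; exists x => //; exists y; rewrite // !inE yD ny.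
have prod_le (D : {fset R[i]}) : (#|` quot true (D `\ 0%R)| <= #|` prodset D D|)%N.
  apply: fsubset_leq_card; apply/fsubsetP => _ /quotP[x [y [xD yD ->]]].
  move: xD yD; rewrite !in_fsetD1 => /andP[_ xD] /andP[ny yD].
  by apply/imfset2P; exists x => //; exists y.
split=> h.
- apply: (main false A _ id) => //; apply: le_trans h; by rewrite ler_nat.
- apply: (main true A _ id) => //; apply: le_trans h; by rewrite ler_nat.
- apply: (main false A _ -%R (@oppr_inj _)) => //; apply: le_trans h; by rewrite ler_nat.
- apply: (main true A _ -%R (@oppr_inj _)) => //; apply: le_trans h; by rewrite ler_nat.
Qed.
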